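(* Let $k$ be a field of characteristic zero, $V$ an irreducible affine variety over $k$ with coordinate ring $R$ and function field $K$, let $L\subset \mathrm{Der}_k(K,K)$ be a $K$-linear Lie subalgebra (an algebraic singular foliation on $V$), $r=\dim_K L$, and let $\delta_1,\dots,\delta_r$ be a $K$-basis of $L$ with $\delta_i\in \mathrm{Der}_k(R,R)$. With $\mathcal{J}$ the operator on ideals of $R$ defined in the context, for every nonzero ideal $I$ of $R$: (i) There is an inclusion $\mathcal{J}(I)^{r+2}\subset \mathcal{J}(I\mathcal{J}(I))$ of ideals of $R$. (ii) If $L$ lifts to a nonsingular foliation on the blowup $Bl_I(V)$, then there is an integer $N\ge 0$ such that $$I^N\mathcal{J}(I)^{r+2}=I^N\mathcal{J}(I\mathcal{J}(I)).$$ (iii) Conversely, if the equality $I^N\mathcal{J}(I)^{r+2}=I^N\mathcal{J}(I\mathcal{J}(I))$ holds for some integer $N\ge 0$, then $L$ lifts to a nonsingular foliation on the Gauss blowup $\widetilde{Bl_I(V)}$ of $Bl_I(V)$ along $L$.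
   Context: $R$ is a finitely generated $k$-algebra without zero divisors and $K$ is its fraction field. Let $x_1,\dots,x_n$ be $k$-algebra generators of $R$. The operator $\mathcal{J}$: for an ideal $I=(f_0,\dots,f_m)$ of $R$, $\mathcal{J}(I)$ is the ideal generated by all $$f_{u_1}f_{u_2}\cdots f_{u_b}\cdot\det\begin{pmatrix} f_{i_1}&\delta_1 f_{i_1}&\dots&\delta_r f_{i_1}\\ &\dots&&\\ f_{i_a}&\delta_1 f_{i_a}&\dots&\delta_r f_{i_a}\\ 0&\delta_1x_{j_1}&\dots&\delta_rx_{j_1}\\ &\dots&&\\ 0&\delta_1x_{j_b}&\dots&\delta_rx_{j_b}\end{pmatrix}$$ where $a+b=r+1$, $0\le u_1,\dots,u_b\le m$, $0\le i_1<\dots<i_a\le m$, $1\le j_1<\dots<j_b\le n$. It does not depend on the choice of generators; equivalently it is the ideal generated by all determinants of $(r+1)\times(r+1)$ matrices with rows $(f,\delta_1 f,\dots,\delta_r f)$, $f\in I$. Nonsingularity: put $\widehat{L}=\mathrm{Hom}_K(L,K)$. Any variety $W$ birational to $V$ has function field $K$, so $L$ also defines a singular foliation on $W$ (the lift of $L$ to $W$). Let $\overline{\Omega_{W/k}}$ be the image of the map from $\Omega_{W/k}$ to the constant sheaf $\widehat{L}$ sending $dx$ to $(\delta\mapsto\delta(x))$. $L$ is nonsingular on $W$ (lifts to a nonsingular foliation on $W$) if $\overline{\Omega_{W/k}}$ is locally free. Gauss blowup: let $\overline{\wedge^r\Omega_{W/k}}$ be the image of $\wedge^r\Omega_{W/k}$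 in the constant sheaf $\wedge^r\widehat{L}\cong K$, a rank one torsion-free coherent sheaf (a sheaf of fractional ideals). The Gauss blowup $\widetilde{W}$ of $W$ along $L$ is the blowup of $W$ along $\overline{\wedge^r\Omega_{W/k}}$. *)

(* Defs.v *)
From HB Require Import structures.
From mathcomp Require Import all_boot all_order all_algebra.
From mathcomp Require Import all_classical.

Set Implicit Arguments.
Unset Strict Implicit.
Unset Printing Implicit Defensive.

Import GRing.Theory.
Local Open Scope classical_set_scope.
Local Open Scope ring_scope.

(* All rings (R, the coordinate rings of the charts of its blowups) are       *)
(* subrings of the field K, given as sets; ideals, fractional ideals and the  *)
(* image of the differentials are subsets of K-vector spaces. The base field  *)
(* k acts on K through a ring morphism iota.                                  *)

Definition subalgebra (k K : fieldType) (iota : {rmorphism k -> K})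
    (A : set K) : Prop :=
  [/\ forall c, A (iota c),
      forall a b, A a -> A b -> A (a + b) &
      forall a b, A a -> A b -> A (a * b)].

Definition algebra_gen (k K : fieldType) (iota : {rmorphism k -> K})
    (n : nat) (x : 'I_n -> K) : set K :=
  smallest (subalgebra iota) (range x).

Definition fraction_field_of (K : fieldType) (R : set K) : Prop :=
  forall z : K, exists a b, [/\ R a, R b, b != 0 & z = a / b].

Definition submodule (K : fieldType) (V : lmodType K) (A : set K)
    (M : set V) : Prop :=
  [/\ M 0,
      forall u v, M u -> M v -> M (u + v) &
      forall a v, A a -> M v -> M (a *: v)].

Definition span (K : fieldType) (V : lmodType K) (A : set K) (G : set V)
    : set V :=
  smallest (submodule A) G.

Definition is_basis (K : fieldType) (V : lmodType K) (A : set K) (M : set V)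
    (s : nat) (e : 'I_s -> V) : Prop :=
  (forall i, M (e i)) /\
  (forall v, M v -> exists! c : 'rV[K]_s,
     (forall i, A (c 0 i)) /\ v = \sum_i c 0 i *: e i).

Definition free_module (K : fieldType) (V : lmodType K) (A : set K)
    (M : set V) : Prop :=
  exists (s : nat) (e : 'I_s -> V), is_basis A M e.

(* Ideals of A are the A-submodules of K (as the K-vector space K^o) that are *)
(* contained in A.                                                            *)
Definition ideal (K : fieldType) (A : set K) (I : set K) : Prop :=
  I `<=` A /\ @submodule K K^o A I.

Definition ideal_gen (K : fieldType) (A : set K) (G : set K) : set K :=
  @span K K^o A G.

Definition ideal_mul (K : fieldType) (A : set K) (I J : set K) : set K :=
  ideal_gen A [set z | exists a b, [/\ I a, J b & z = a * b]].

Fixpoint ideal_exp (K : fieldType) (A : set K) (I : set K) (n : nat)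
    : set K :=
  if n is n'.+1 then ideal_mul A I (ideal_exp A I n') else A.

Definition prime_ideal (K : fieldType) (A : set K) (P : set K) : Prop :=
  [/\ ideal A P, ~ P 1 &
      forall a b, A a -> A b -> P (a * b) -> P a \/ P b].

(* The localization M_g, for g != 0, inside the ambient K-vector space.       *)
Definition localization (K : fieldType) (V : lmodType K) (g : K) (M : set V)
    : set V :=
  [set v | exists n : nat, M (g ^+ n *: v)].

(* The quasi-coherent sheaf on Spec A associated with M is locally free:      *)
(* every point P has a neighbourhood D(g) on which it is free.                *)
Definition locally_free (K : fieldType) (V : lmodType K) (A : set K)
    (M : set V) : Prop :=
  forall P : set K, prime_ideal A P ->
  exists g : K, [/\ A g, ~ P g &
    free_module (@localization K K^o g A) (localization g M)].

Definition kderivation (k K : fieldType) (iota : {rmorphism k -> K})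
    (d : K -> K) : Prop :=
  [/\ forall a b, d (a + b) = d a + d b,
      forall a b, d (a * b) = d a * b + a * d b &
      forall c, d (iota c) = 0].

(* K-linear Lie subalgebras of Der_k(K, K).                                   *)
Definition foliation (k K : fieldType) (iota : {rmorphism k -> K})
    (L : set (K -> K^o)) : Prop :=
  [/\ forall d, L d -> kderivation iota d,
      submodule setT L &
      forall d e, L d -> L e -> L (fun y => d (e y) - e (d y))].

Definition calJ_elements (K : fieldType) (n : nat) (x : 'I_n -> K)
    (r : nat) (delta : 'I_r -> K -> K^o) (m : nat) (f : 'I_m.+1 -> K)
    : set K :=
  [set z | exists (a b : nat) (hab : (a + b = 1 + r)%N)
      (u : 'I_b -> 'I_m.+1) (i : 'I_a -> 'I_m.+1) (j : 'I_b -> 'I_n),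
    [/\ forall s t : 'I_a, (s < t)%N -> (i s < i t)%N,
        forall s t : 'I_b, (s < t)%N -> (j s < j t)%N &
        z = (\prod_(s < b) f (u s)) *
            \det (castmx (hab, erefl (1 + r)%N)
              (block_mx (\col_(s < a) f (i s))
                        (\matrix_(s < a, t < r) (delta t (f (i s)) : K))
                        (0 : 'M[K]_(b, 1))
                        (\matrix_(s < b, t < r) (delta t (x (j s)) : K))))]].

(* J is calJ(I), computed from some finite system f_0, ..., f_m of generators *)
(* of I; by the Hilbert basis theorem every ideal of R has such systems.      *)
Definition is_calJ (K : fieldType) (R : set K) (n : nat) (x : 'I_n -> K)
    (r : nat) (delta : 'I_r -> K -> K^o) (I J : set K) : Prop :=
  exists (m : nat) (f : 'I_m.+1 -> K),
    I = ideal_gen R (range f) /\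
    J = ideal_gen R (calJ_elements x delta f).

(* A variety with function field K is represented by the set of coordinate    *)
(* rings, inside K, of the charts of an affine open cover.                    *)
Definition model (K : fieldType) : Type := set (set K).

Definition affine (K : fieldType) (R : set K) : model K := [set R].

(* The elements of M^n / f^n, n >= 0: the coordinate ring of the chart        *)
(* D_+(f) of Proj of the sum of the M^n, for f in M of degree 1.              *)
Definition blowup_chart (K : fieldType) (A M : set K) (f : K) : set K :=
  [set z | exists (n : nat) (c : K), ideal_exp A M n c /\ z = c / f ^+ n].

(* Blowup of W along the sheaf of fractional ideals given by M A on the       *)
(* chart A.                                                                   *)
Definition blowup (K : fieldType) (W : model K) (M : set K -> set K)
    : model K :=
  [set B | exists (A : set K) (f : K),
     [/\ W A, M A f, f != 0 & B = blowup_chart A (M A) f]].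

(* An ideal I of R generates the ideal sheaf of I on Spec R.                  *)
Definition Bl (K : fieldType) (R I : set K) : model K :=
  blowup (affine R) (fun=> I).

(* dx in the dual of L: the function delta |-> delta(x). The A-span of these, *)
(* taken in all functions L -> K, consists of K-linear functions.             *)
Definition diff (K : fieldType) (L : set (K -> K^o)) (x : K) : L -> K^o :=
  fun d => set_val d x.
Arguments diff {K} L x _.

Definition Omega_bar (K : fieldType) (L : set (K -> K^o)) (A : set K)
    : set (L -> K^o) :=
  span A (diff L @` A).
Arguments Omega_bar {K} L A _.

(* Image of the r-th exterior power of the differentials under the            *)
(* isomorphism of the r-th exterior power of the dual of L with K given by    *)
(* evaluation at delta_1 /\ ... /\ delta_r.                                   *)
Definition wedge_Omega_bar (K : fieldType) (r : nat)
    (delta : 'I_r -> K -> K^o) (A : set K) : set K :=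
  ideal_gen A [set z | exists y : 'I_r -> K, (forall i, A (y i)) /\
     z = \det (\matrix_(i < r, j < r) (delta j (y i) : K))].

Definition nonsingular_on (K : fieldType) (L : set (K -> K^o)) (W : model K)
    : Prop :=
  forall A : set K, W A -> locally_free A (Omega_bar L A).

Definition Gauss_blowup (K : fieldType) (r : nat) (delta : 'I_r -> K -> K^o)
    (W : model K) : model K :=
  blowup W (wedge_Omega_bar delta).

(* Main.v *)
Require Import Defs.
From HB Require Import structures.
From mathcomp Require Import all_boot all_order all_algebra.
From mathcomp Require Import perm all_classical.

Set Implicit Arguments.
Unset Strict Implicit.
Unset Printing Implicit Defensive.

Import GRing.Theory.
Local Open Scope classical_set_scope.
Local Open Scope ring_scope.

Local Notation span := Defs.span.

(** For an A-submodule M of K let W_A(M) be the A-module generated by the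
determinants with rows the jets (y, delta_1 y, ..., delta_r y), y in M. Then
calJ(I) = W_R(I), W_A(fM) = f^(r+1) W_A(M), and W_A(A) =: w_A is the module of
r-forms, the image of the r-th exterior power of the differentials.

(i) Multiplying all the rows by z in J = calJ(I) gives z^(r+1) J inside
calJ(IJ); in characteristic zero the (r+1)-st powers generate J^(r+1), by
polarization.

On the chart B = R[I/f] of the blowup of I, the module of jets of I J' extends
to that of I J' B for every J', because
f (0, delta(g/f)) = jet(g) - (g/f) jet(f). Hence, up to the power
f^((r+1)(r+2)), J^(r+2) and calJ(IJ) extend to w_B^(r+2) and W_B(w_B), and the
equality in the theorem says that these coincide on all the charts.

(ii) If the differentials are locally free then w_B is locally generated by one
element h, and both sides are h^(r+2) B.

(iii) On a chart C of the blowup of w_B, w_B C = h C, and the same extension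
argument turns W_B(w_B) = w_B^(r+2) into w_C = h C. Near a point, h is then
up to a unit a single determinant det(delta_j y_i), and Cramer's rule shows
that dy_1, ..., dy_r is a basis of the differentials. *)

(** * Modules over subrings of K and charts of blowups *)

Section Span.
Variables (K : fieldType) (V : lmodType K).
Implicit Types (A B : set K) (G M : set V).

Lemma span_submodule A G : submodule A (span A G).
Proof.
split=> [M [[]] //|u v Gu Gv M GM|a v Aa Gv M GM];
  have [[_ MD MZ] _] := GM; first by apply: MD; [apply: Gu|apply: Gv].
by apply: MZ => //; apply: Gv.
Qed.

Lemma sub_span A G : G `<=` span A G.
Proof. exact: sub_gen_smallest. Qed.

Lemma span_min A G M : submodule A M -> G `<=` M -> span A G `<=` M.
Proof. exact: smallest_sub. Qed.

Lemma submoduleW A B M : A `<=` B -> submodule B M -> submodule A M.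
Proof. by move=> AB [M0 MD MZ]; split=> // a v /AB; apply: MZ. Qed.

Lemma span_mono A G M : G `<=` M -> span A G `<=` span A M.
Proof.
by move=> GM; apply: span_min (span_submodule _ _) _ => v /GM; apply: sub_span.
Qed.

Lemma span_tower A B G : A `<=` B -> span B (span A G) = span B G.
Proof.
move=> AB; apply/seteqP; split.
  apply: span_min (span_submodule _ _) _; apply: span_min; last exact: sub_span.
  exact: submoduleW AB (span_submodule _ _).
exact: span_mono (@sub_span _ _).
Qed.

Lemma submodule_sum A M (I : Type) (s : seq I) (P : pred I) (F : I -> V) :
  submodule A M -> (forall i, P i -> M (F i)) -> M (\sum_(i <- s | P i) F i).
Proof. by move=> [M0 MD _] MF; elim/big_ind: _ => // u v; apply: MD. Qed.

End Span.

Lemma gen_submodule (K : fieldType) (A X : set K) : @submodule K K^o A (ideal_gen A X).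
Proof. exact: span_submodule. Qed.

Lemma sub_gen (K : fieldType) (A X : set K) : X `<=` ideal_gen A X.
Proof. exact: (@sub_span K K^o). Qed.

Lemma gen_min (K : fieldType) (A X M : set K) :
  @submodule K K^o A M -> X `<=` M -> ideal_gen A X `<=` M.
Proof. exact: (@span_min K K^o). Qed.

Lemma gen_tower (K : fieldType) (A B X : set K) :
  A `<=` B -> ideal_gen B (ideal_gen A X) = ideal_gen B X.
Proof. exact: (@span_tower K K^o). Qed.

Definition prodset (K : fieldType) (X Y : set K) : set K :=
  [set z | exists a b, [/\ X a, Y b & z = a * b]].

Definition scaled (K : fieldType) (c : K) (X : set K) : set K :=
  [set c * y | y in X].

Section Scaled.
Variable K : fieldType.
Implicit Types (A X Y : set K) (c d : K).

Lemma scaledM c d X : scaled c (scaled d X) = scaled (c * d) X.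
Proof.
apply/seteqP; split=> [_ [_ [y Xy <-] <-]|_ [y Xy <-]].
  by exists y => //; rewrite mulrA.
by rewrite -mulrA; exists (d * y) => //; exists y.
Qed.

Lemma scaled1 X : scaled 1 X = X.
Proof.
apply/seteqP; split=> [_ [y Xy <-]|y Xy]; first by rewrite mul1r.
by exists y; rewrite ?mul1r.
Qed.

Lemma scaled_inj c X Y : c != 0 -> scaled c X = scaled c Y -> X = Y.
Proof. by move=> c0 /(congr1 (scaled c^-1)); rewrite !scaledM mulVf// !scaled1. Qed.

Lemma scaled_mono c X Y : X `<=` Y -> scaled c X `<=` scaled c Y.
Proof. by move=> XY _ [y /XY Yy <-]; exists y. Qed.

Lemma scaledP c X z : c != 0 -> scaled c X z <-> X (c^-1 * z).
Proof.
move=> c0; split=> [[y Xy <-]|Xz]; first by rewrite mulrA mulVf ?mul1r.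
by exists (c^-1 * z); rewrite ?mulrA ?mulfV ?mul1r.
Qed.

Lemma scaled_submodule A c (X : set K) :
  @submodule K K^o A X -> @submodule K K^o A (scaled c X).
Proof.
move=> [X0 XD XM]; split=> [|_ _ [u Xu <-] [v Xv <-]|a _ Aa [v Xv <-]].
- by exists 0; rewrite ?mulr0.
- by exists (u + v); [apply: XD|rewrite mulrDr].
- by exists (a * v); [apply: XM|rewrite /= mulrCA].
Qed.

Lemma scaled_gen A c X : scaled c (ideal_gen A X) = ideal_gen A (scaled c X).
Proof.
apply/seteqP; split=> [_ [y Xy <-]|].
  suff: ideal_gen A X `<=` [set y | ideal_gen A (scaled c X) (c * y)] by apply.
  have [Z0 ZD ZM] := @gen_submodule K A (scaled c X).
  apply: gen_min; last by move=> z Xz; apply: sub_gen; exists z.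
  split=> [|u v /= Zu Zv|a v /= Aa Zv]; first by rewrite /= mulr0.
    by rewrite mulrDr; apply: ZD.
  by rewrite mulrCA; apply: ZM.
apply: gen_min (scaled_submodule _ (gen_submodule _ _)) _.
by apply: scaled_mono; apply: sub_gen.
Qed.

Lemma prodset_scaled c d X Y :
  prodset (scaled c X) (scaled d Y) = scaled (c * d) (prodset X Y).
Proof.
apply/seteqP; split=> [_ [_ [_ [[a Xa <-] [b Yb <-] ->]]]|_ [_ [a [b [Xa Yb ->]]] <-]].
  by rewrite mulrACA; exists (a * b) => //; exists a, b.
by rewrite mulrACA; exists (c * a), (d * b); split=> //; [exists a|exists b].
Qed.

Lemma ideal_mul_scaled A c d X Y :
  ideal_mul A (scaled c X) (scaled d Y) = scaled (c * d) (ideal_mul A X Y).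
Proof.
rewrite /ideal_mul -/(prodset (scaled c X) _) prodset_scaled.
by rewrite -scaled_gen.
Qed.

Lemma ideal_exp_scaled A c X n :
  ideal_exp A (scaled c X) n = scaled (c ^+ n) (ideal_exp A X n).
Proof.
elim: n => [|n IHn]; first by rewrite expr0 scaled1.
by rewrite /= IHn ideal_mul_scaled exprS.
Qed.

End Scaled.

(** * Products and powers of submodules of [K] *)

Section IdealOps.
Variables (k K : fieldType) (iota : {rmorphism k -> K}).
Implicit Types (A B X Y Z M : set K).
Local Notation subalgebra := (subalgebra iota).

Lemma subalg1 A : subalgebra A -> A 1.
Proof. by case=> Ai _ _; rewrite -(rmorph1 iota). Qed.

Lemma subalg0 A : subalgebra A -> A 0.
Proof. by case=> Ai _ _; rewrite -(rmorph0 iota). Qed.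

Lemma subalgN A a : subalgebra A -> A a -> A (- a).
Proof.
by case=> Ai _ AM Aa; rewrite -mulN1r -(rmorphN1 iota); apply: AM.
Qed.

Lemma subalg_submodule A : subalgebra A -> @submodule K K^o A A.
Proof. by move=> sA; have [_ AD AM] := sA; split=> //; apply: subalg0 sA. Qed.

Lemma submoduleN (V : lmodType K) A (M : set V) v :
  subalgebra A -> submodule A M -> M v -> M (- v).
Proof.
move=> sA [_ _ MZ] Mv; rewrite -scaleN1r; apply: MZ => //.
by apply: (subalgN sA); apply: subalg1 sA.
Qed.

Lemma submoduleB (V : lmodType K) A (M : set V) u v :
  subalgebra A -> submodule A M -> M u -> M v -> M (u - v).
Proof.
by move=> sA sM Mu Mv; have [_ MD _] := sM; apply: MD => //; apply: submoduleN sA sM Mv.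
Qed.

Lemma ideal_mul_submodule A X Y : @submodule K K^o A (ideal_mul A X Y).
Proof. exact: gen_submodule. Qed.

Lemma ideal_mul_in A X Y a b : X a -> Y b -> ideal_mul A X Y (a * b).
Proof. by move=> Xa Yb; apply: sub_gen; exists a, b. Qed.

Lemma ideal_mul_min A X Y M : @submodule K K^o A M ->
  (forall a b, X a -> Y b -> M (a * b)) -> ideal_mul A X Y `<=` M.
Proof. by move=> sM XYM; apply: gen_min => // _ [a [b [Xa Yb ->]]]; apply: XYM. Qed.

Lemma ideal_mul_mono A X Y X' Y' : X `<=` X' -> Y `<=` Y' ->
  ideal_mul A X Y `<=` ideal_mul A X' Y'.
Proof.
move=> XX' YY'; apply: ideal_mul_min (ideal_mul_submodule _ _ _) _ => a b Xa Yb.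
by apply: ideal_mul_in; [apply: XX'|apply: YY'].
Qed.

Lemma ideal_mulC A X Y : ideal_mul A X Y = ideal_mul A Y X.
Proof.
by apply/seteqP; split; apply: ideal_mul_min (ideal_mul_submodule _ _ _) _ =>
  a b Xa Yb; rewrite mulrC; apply: ideal_mul_in.
Qed.

Lemma submodule_preim A c M : @submodule K K^o A M ->
  @submodule K K^o A [set b | M (c * b)].
Proof.
move=> [M0 MD MM]; split=> [|u v /= Mu Mv|a v /= Aa Mv].
- by rewrite /= mulr0.
- by rewrite mulrDr; apply: MD.
- by rewrite mulrCA; apply: MM.
Qed.

(** Multiplication by a fixed element pulls submodules back to submodules, so the second factor may
    be tested on generators, even when these generate only over the smaller ring [A]. *)
Lemma ideal_mul_genr A B X Y : A `<=` B ->
  ideal_mul B X (ideal_gen A Y) = ideal_mul B X Y.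
Proof.
move=> AB; apply/seteqP; split; last by apply: ideal_mul_mono => //; apply: sub_gen.
have sM := ideal_mul_submodule B X Y.
apply: ideal_mul_min => // a b Xa; move: b; apply: gen_min.
  by apply: submodule_preim; apply: submoduleW AB _.
by move=> b Yb; apply: ideal_mul_in.
Qed.

Lemma ideal_mul_genl A B X Y : A `<=` B ->
  ideal_mul B (ideal_gen A X) Y = ideal_mul B X Y.
Proof. by move=> AB; rewrite ideal_mulC ideal_mul_genr// ideal_mulC. Qed.

Lemma ideal_mulA A X Y Z :
  ideal_mul A X (ideal_mul A Y Z) = ideal_mul A (ideal_mul A X Y) Z.
Proof.
rewrite /(ideal_mul A Y Z) ideal_mul_genr// /(ideal_mul A X Y) ideal_mul_genl//.
congr ideal_gen; apply/seteqP.
split=> [_ [a [_ [Xa [b [c [Yb Zc ->]]] ->]]]|_ [_ [c [[a [b [Xa Yb ->]]] Zc ->]]]].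
  by rewrite mulrA; exists (a * b), c; split=> //; exists a, b.
by rewrite -mulrA; exists a, (b * c); split=> //; exists b, c.
Qed.

Lemma ideal_mul1 A M : subalgebra A -> @submodule K K^o A M -> ideal_mul A A M = M.
Proof.
move=> sA sM; apply/seteqP; split.
  by apply: ideal_mul_min => // a b Aa Mb; case: sM => _ _; apply.
by move=> y My; rewrite -(mul1r y); apply: ideal_mul_in => //; apply: subalg1.
Qed.

Lemma ideal_exp_submodule A X n :
  subalgebra A -> @submodule K K^o A (ideal_exp A X n).
Proof. by case: n => [|n] sA; [apply: subalg_submodule|apply: gen_submodule]. Qed.

Lemma ideal_exp1 A M : subalgebra A -> @submodule K K^o A M -> ideal_exp A M 1 = M.
Proof. by move=> sA sM; rewrite /= ideal_mulC ideal_mul1. Qed.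

Lemma ideal_expD A X m n : subalgebra A ->
  ideal_mul A (ideal_exp A X m) (ideal_exp A X n) = ideal_exp A X (m + n).
Proof.
move=> sA; elim: m => [|m IHm] /=.
  by rewrite ideal_mul1//; apply: ideal_exp_submodule.
by rewrite -ideal_mulA IHm.
Qed.

Lemma ideal_exp_in A X m n a b : subalgebra A ->
  ideal_exp A X m a -> ideal_exp A X n b -> ideal_exp A X (m + n) (a * b).
Proof. by move=> sA Xa Xb; rewrite -ideal_expD//; apply: ideal_mul_in. Qed.

Lemma ideal_exp_expr A X n a : subalgebra A -> X a -> ideal_exp A X n (a ^+ n).
Proof.
move=> sA Xa; elim: n => [|n IHn]; first exact: subalg1.
by rewrite exprS; apply: ideal_mul_in.
Qed.

Lemma gen_subalg A B : subalgebra A -> subalgebra B -> A `<=` B -> ideal_gen B A = B.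
Proof.
move=> sA sB AB; apply/seteqP; split; first exact: gen_min (subalg_submodule _) _.
move=> b Bb; rewrite -(mulr1 b).
have [_ _ H] := @gen_submodule K B A; apply: H => //.
by apply: sub_gen; apply: subalg1 sA.
Qed.

Lemma gen_ideal_mul A B X Y : A `<=` B ->
  ideal_gen B (ideal_mul A X Y) = ideal_mul B (ideal_gen B X) (ideal_gen B Y).
Proof.
by move=> AB; rewrite ideal_mul_genr// ideal_mul_genl// [LHS]span_tower.
Qed.

Lemma gen_ideal_exp A B X n : subalgebra A -> subalgebra B -> A `<=` B ->
  ideal_gen B (ideal_exp A X n) = ideal_exp B (ideal_gen B X) n.
Proof.
move=> sA sB AB; elim: n => [|n IHn]; first exact: gen_subalg.
by rewrite /= gen_ideal_mul// IHn.
Qed.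

End IdealOps.

(** * Extension and contraction between a ring and a chart of a blowup *)

Section Charts.
Variables (k K : fieldType) (iota : {rmorphism k -> K}).
Variables (A M : set K) (f : K).
Hypotheses (sA : subalgebra iota A) (sM : @submodule K K^o A M).
Hypotheses (Mf : M f) (f0 : f != 0).
Let B := blowup_chart A M f.

Lemma sub_chart : A `<=` B.
Proof. by move=> a Aa; exists 0%N, a; rewrite expr0 divr1. Qed.

Lemma chart_frac g : M g -> B (g / f).
Proof.
by move=> Mg; exists 1%N, g; split; rewrite // (ideal_exp1 sA).
Qed.

Lemma chart_subalgebra : subalgebra iota B.
Proof.
split=> [c|_ _ [m [a [Ma ->]]] [n [b [Mb ->]]]|_ _ [m [a [Ma ->]]] [n [b [Mb ->]]]].
- by apply: sub_chart; case: sA.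
- exists (m + n)%N, (a * f ^+ n + b * f ^+ m); split; last first.
    by rewrite exprD addf_div ?expf_neq0.
  have [_ MD _] := ideal_exp_submodule M (m + n) sA; apply: MD.
    by apply: (ideal_exp_in sA) => //; apply: (ideal_exp_expr _ sA).
  by rewrite addnC; apply: (ideal_exp_in sA) => //; apply: (ideal_exp_expr _ sA).
- exists (m + n)%N, (a * b); split; first exact: (ideal_exp_in sA).
  by rewrite exprD mulf_div.
Qed.

(** Each g in [M] is f times the element g/f of the chart, so [M] becomes principal there. *)
Lemma gen_chart : ideal_gen B M = scaled f B.
Proof.
have sB := chart_subalgebra.
apply/seteqP; split.
  apply: gen_min; first by apply: scaled_submodule; apply: subalg_submodule sB.
  by move=> g Mg; apply/scaledP => //; rewrite mulrC; apply: chart_frac.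
have [_ _ ZM] := @gen_submodule K B M.
by move=> _ [b Bb <-]; rewrite mulrC; apply: ZM => //; apply: sub_gen.
Qed.

(** An element of the extension of [X] is a finite sum of terms (c / f^n) x with c in M^n; one high
    power of f clears all denominators. *)
Lemma chart_clear y (X : set K) :
  ideal_gen B X y -> exists n, ideal_mul A (ideal_exp A M n) X (f ^+ n * y).
Proof.
have sE n := ideal_mul_submodule A (ideal_exp A M n) X.
(* Since f lies in [M], exponents can be raised, and terms with different denominators can be
   added. *)
have up m n z : ideal_mul A (ideal_exp A M n) X z ->
    ideal_mul A (ideal_exp A M (m + n)) X (f ^+ m * z).
  move: z; apply: ideal_mul_min; first by apply: submodule_preim.
  move=> a b Ma Xb; rewrite mulrA; apply: ideal_mul_in => //.
  by apply: (ideal_exp_in sA) Ma; apply: (ideal_exp_expr _ sA).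
move: y; apply: gen_min; last first.
  by move=> y Xy; exists 0%N; apply: ideal_mul_in => //; rewrite expr0; apply: subalg1 sA.
split=> [|u v [m Eu] [n Ev]|_ v [m [a [Ma ->]]] [n Ev]].
- by exists 0%N; rewrite mulr0; case: (sE 0%N).
- exists (m + n)%N; rewrite mulrDr; case: (sE (m + n)%N) => _ ED _; apply: ED.
    by rewrite {2}addnC exprD -mulrA addnC; apply: up.
  by rewrite exprD -mulrA; apply: up.
- exists (m + n)%N; rewrite exprD /GRing.scale /=.
  have -> : f ^+ m * f ^+ n * (a / f ^+ m * v) = a * (f ^+ n * v).
    by rewrite mulrACA [f ^+ m * _]mulrC divfK ?expf_neq0.
  move: (f ^+ n * v) Ev; apply: ideal_mul_min; first by apply: submodule_preim.
  by move=> c d Mc Xd; rewrite mulrA; apply: ideal_mul_in Xd; apply: (ideal_exp_in sA).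
Qed.

End Charts.

(** * Determinants of jets *)

Section DetSpan.
Variables (K : fieldType) (p : nat).
Implicit Types (A : set K) (S : set 'rV[K]_p).

Definition detset S : set K :=
  [set z | exists v : 'I_p -> 'rV[K]_p,
     (forall i, S (v i)) /\ z = \det (\matrix_i v i)].

Lemma det_row_submodule A (M : set K) (v : 'I_p -> 'rV[K]_p) i0 :
  @submodule K K^o A M ->
  submodule A [set w | M (\det (\matrix_i (if i == i0 then w else v i)))].
Proof.
set d := fun w => \det (\matrix_i (if i == i0 then w else v i)).
have dlin b c u w : d (b *: u + c *: w) = b * d u + c * d w.
  apply: (@determinant_multilinear _ _ _ _ _ i0).
  - by apply/rowP=> j; rewrite !mxE eqxx !mxE.
  - by apply/matrixP=> i j; rewrite !mxE eq_sym (negPf (neq_lift _ _)).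
  - by apply/matrixP=> i j; rewrite !mxE eq_sym (negPf (neq_lift _ _)).
move=> [M0 MD MM]; split=> [|u w /= Mu Mw|a w /= Aa Mw].
- by rewrite /= -/(d 0) -[0](scale0r (0 : 'rV_p)) -[0 *: _]addr0 -{2}(scale0r 0) dlin !mul0r addr0.
- by rewrite -/(d (u + w)) -[u]scale1r -[w]scale1r dlin !mul1r; apply: MD.
- by rewrite -/(d (a *: w)) -[a *: w]addr0 -(scale0r 0) dlin mul0r addr0; apply: MM.
Qed.

Lemma det_span A (M : set K) S : @submodule K K^o A M ->
  detset S `<=` M -> detset (span A S) `<=` M.
Proof.
move=> sM SM _ [v [Sv ->]].
(* The rows are released from [S] to its span one at a time: the first m rows may lie in the span,
   the others are still in [S]. *)
suff H m (w : 'I_p -> 'rV[K]_p) : (forall i : 'I_p, (i < m)%N -> span A S (w i)) ->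
    (forall i : 'I_p, (m <= i)%N -> S (w i)) -> M (\det (\matrix_i w i)).
  by apply: (H p) => // i; rewrite leqNgt ltn_ord.
elim: m w => [|m IHm] w Sw1 Sw2.
  by apply: SM; exists w; split=> // i; apply: Sw2.
have [pm|mp] := leqP p m.
  by apply: IHm => i im; [apply: Sw1; apply: ltnW|have := leq_trans pm im; rewrite leqNgt ltn_ord].
pose i0 := Ordinal mp.
have -> : \matrix_i w i = \matrix_i (if i == i0 then w i0 else w i).
  by apply/matrixP=> i j; rewrite !mxE; case: eqP => [->|].
move: (w i0) (Sw1 i0 (leqnn _)).
apply: span_min; first exact: det_row_submodule.
move=> u Su /=; apply: IHm => i im; case: eqP => ii0.
- by apply: sub_span.
- by apply: Sw1; apply: ltnW.
- by [].
- by apply: Sw2; rewrite ltn_neqAle im andbT; apply: contra_notN ii0 => /eqP ?; apply: val_inj.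
Qed.

Lemma gen_detset_span A S :
  ideal_gen A (detset (span A S)) = ideal_gen A (detset S).
Proof.
apply/seteqP; split; apply: gen_min (gen_submodule _ _) _.
  by apply: det_span (gen_submodule _ _) _; apply: sub_gen.
move=> _ [v [Sv ->]]; apply: sub_gen; exists v; split=> // i.
by apply: sub_span.
Qed.

Lemma detset_mulmx (T : 'M[K]_p) S :
  detset [set v *m T | v in S] = scaled (\det T) (detset S).
Proof.
have mulT (v : 'I_p -> 'rV[K]_p) : \matrix_i (v i *m T) = (\matrix_i v i) *m T.
  by apply/row_matrixP=> i; rewrite row_mul !rowK.
apply/seteqP; split=> [_ [w [Sw ->]]|_ [_ [v [Sv ->]] <-]].
  have /choice[v Sv] i : exists u, S u /\ u *m T = w i.
    by have [u Su <-] := Sw i; exists u.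
  have -> : \matrix_i w i = (\matrix_i v i) *m T.
    by rewrite -mulT; apply/matrixP=> i j; rewrite !mxE; have [_ <-] := Sv i; rewrite mxE.
  rewrite det_mulmx mulrC; exists (\det (\matrix_i v i)) => //.
  by exists v; split=> // i; have [] := Sv i.
exists (fun i => v i *m T); split; first by move=> i; exists (v i).
by rewrite mulT det_mulmx mulrC.
Qed.

End DetSpan.

(** * Jets and their determinants under extension of the ring *)

Section Jets.
Variables (k K : fieldType) (iota : {rmorphism k -> K}).
Variables (r : nat) (delta : 'I_r -> K -> K^o).
Hypothesis dder : forall t, kderivation iota (delta t).
Implicit Types (A B M : set K).
Local Notation subalgebra := (subalgebra iota).

Definition dvec (y : K) : 'rV[K]_r := \row_t (delta t y : K).

(* The rows (f, delta_1 f, ..., delta_r f) and (0, delta_1 y, ..., delta_r y)  *)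
(* of the matrices in the definition of calJ.                                 *)
Definition jet (y : K) : 'rV[K]_(1 + r) := row_mx y%:M (dvec y).
Definition djet (y : K) : 'rV[K]_(1 + r) := row_mx 0 (dvec y).

Lemma dvecD a b : dvec (a + b) = dvec a + dvec b.
Proof. by apply/rowP=> t; rewrite !mxE; case: (dder t) => ->. Qed.

Lemma dvecM a b : dvec (a * b) = a *: dvec b + b *: dvec a.
Proof.
by apply/rowP=> t; rewrite !mxE; case: (dder t) => _ -> _; rewrite addrC [_ * b]mulrC.
Qed.

Lemma dvec_iota c : dvec (iota c) = 0.
Proof. by apply/rowP=> t; rewrite !mxE; case: (dder t). Qed.

Lemma djetD a b : djet (a + b) = djet a + djet b.
Proof. by rewrite /djet dvecD add_row_mx addr0. Qed.

Lemma djetM a b : djet (a * b) = a *: djet b + b *: djet a.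
Proof. by rewrite /djet dvecM !scale_row_mx add_row_mx !scaler0 addr0. Qed.

Lemma djet_iota c : djet (iota c) = 0.
Proof. by rewrite /djet dvec_iota row_mx0. Qed.

Lemma jetD a b : jet (a + b) = jet a + jet b.
Proof. by rewrite /jet dvecD add_row_mx raddfD. Qed.

Lemma jetM a b : jet (a * b) = a *: jet b + b *: djet a.
Proof.
by rewrite /jet dvecM !scale_row_mx add_row_mx scaler0 addr0 scale_scalar_mx.
Qed.

Lemma jet0 : jet 0 = 0.
Proof. by rewrite -[0](rmorph0 iota) /jet dvec_iota rmorph0 raddf0 row_mx0. Qed.

(** The module W_A(M). Here [M] is any subset of [K], so that fractional ideals such as w_B are
    allowed as arguments. *)
Definition wronskian A M : set K := ideal_gen A (detset (jet @` M)).

Lemma wronskian_submodule A M : @submodule K K^o A (wronskian A M).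
Proof. exact: gen_submodule. Qed.

(* Multiplication by f acts on jets as a block triangular matrix with f on the *)
(* diagonal.                                                                  *)
Lemma wronskian_scaled A M f :
  wronskian A (scaled f M) = scaled (f ^+ r.+1) (wronskian A M).
Proof.
pose T : 'M[K]_(1 + r) := block_mx f%:M (dvec f) 0 f%:M.
have jetT y : jet (f * y) = jet y *m T.
  rewrite mulrC jetM mul_row_block mulmx0 addr0 mul_scalar_mx scale_scalar_mx.
  rewrite mul_mx_scalar mul_scalar_mx /jet /djet !scale_row_mx add_row_mx.
  by rewrite scaler0 addr0 scale_scalar_mx addrC.
have detT : \det T = f ^+ r.+1 by rewrite det_ublock !det_scalar expr1 exprS.
rewrite /wronskian -detT scaled_gen -detset_mulmx; congr (ideal_gen A (detset _)).
apply/seteqP; split=> [_ [_ [y My <-] <-]|_ [_ [y My <-] <-]].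
  by exists (jet y); [exists y|].
by exists (f * y); [exists y|].
Qed.

Lemma wronskian_mono A M N : M `<=` N -> wronskian A M `<=` wronskian A N.
Proof.
move=> MN; apply: gen_min (gen_submodule _ _) _ => _ [v [Mv ->]].
apply: sub_gen; exists v; split=> // i.
by have [y My <-] := Mv i; exists y => //; apply: MN.
Qed.

(** By the Leibniz rule jet(by) = b jet(y) + y djet(b), so the last hypothesis puts the jets of the
    extended module into the [B]-span of the jets of [M]. *)
Lemma wronskian_ext A B M : subalgebra A -> subalgebra B -> A `<=` B ->
  (forall a y, B a -> M y -> span B (jet @` M) (y *: djet a)) ->
  wronskian B (ideal_gen B M) = ideal_gen B (wronskian A M).
Proof.
move=> sA sB AB HM.
rewrite /wronskian gen_tower//.
rewrite -(gen_detset_span B (jet @` M)) -(gen_detset_span B (jet @` ideal_gen B M)).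
congr (ideal_gen B (detset _)).
have [S0 SD SZ] := span_submodule B (jet @` M).
apply/seteqP; split; last first.
  by apply: span_mono => _ [y My <-]; exists y => //; apply: sub_gen.
apply: span_min (span_submodule _ _) _ => _ [y By <-].
(* The condition on y djet(a) has to be carried along: it is what makes the set of good y stable
   under multiplication by [B]. *)
suff: ideal_gen B M `<=` [set y | span B (jet @` M) (jet y) /\
    forall a, B a -> span B (jet @` M) (y *: djet a)] by move=> /(_ y By) [].
apply: gen_min; last first.
  by move=> z Mz; split=> [|a Ba]; [apply: sub_span; exists z|apply: HM].
split=> [|u v [Su Ru] [Sv Rv]|b v Bb [Sv Rv]].
- by split=> [|a _]; rewrite ?jet0 ?scale0r.
- by split=> [|a Ba]; rewrite ?jetD ?scalerDl; apply: SD; auto.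
- split=> [|a Ba].
    by rewrite jetM; apply: SD; [apply: SZ|apply: Rv].
  by rewrite -scalerA; apply: SZ => //; apply: Rv.
Qed.

(** The hypothesis of [wronskian_ext] has to be checked for the generators g/f of the chart. The
    factor [I] of [M] allows this, since inside [M] one element of [I] can be exchanged for
    another. *)
Lemma wronskian_chart A (I J : set K) (f : K) : subalgebra A -> @submodule K K^o A I ->
  I f -> f != 0 -> let B := blowup_chart A I f in let M := ideal_mul A I J in
  wronskian B (ideal_gen B M) = ideal_gen B (wronskian A M).
Proof.
move=> sA sI If f0 B M.
have sB : subalgebra B by apply: chart_subalgebra.
have AB : A `<=` B by apply: sub_chart.
have Bfrac (g : K) : I g -> B (g / f) by move=> Ig; apply: (chart_frac f sA sI).
have [S0 SD SZ] := span_submodule B (jet @` M).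
have Sjet y : M y -> span B (jet @` M) (jet y) by move=> My; apply: sub_span; exists y.
apply: (wronskian_ext sA) => //.
(* The elements a whose differential is harmless are closed under sums and products; it remains to
   find [A] and all the g/f among them. *)
pose E := [set a | B a /\ forall y, M y -> span B (jet @` M) (y *: djet a)].
have EM a b : E a -> E b -> E (a * b).
  move=> [Ba Ea] [Bb Eb]; split=> [|y My]; first by case: sB => _ _; apply.
  rewrite djetM scalerDr !scalerA ![y * _]mulrC -!scalerA.
  by apply: SD; apply: SZ => //; [apply: Eb|apply: Ea].
have ED a b : E a -> E b -> E (a + b).
  move=> [Ba Ea] [Bb Eb]; split=> [|y My]; first by case: sB => _ + _; apply.
  by rewrite djetD scalerDr; apply: SD; [apply: Ea|apply: Eb].
have EA a : A a -> E a.
  move=> Aa; split=> [|y My]; first exact: AB.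
  have -> : y *: djet a = jet (a * y) - a *: jet y by rewrite jetM addrC addKr.
  apply: (submoduleB sB (span_submodule _ _)).
    by apply: Sjet; have [_ _ MM] := ideal_mul_submodule A I J; apply: MM.
  by apply: SZ; [apply: AB|apply: Sjet].
have EI g : I g -> E (g / f).
  move=> Ig; split=> [|y]; first exact: Bfrac.
  move: y; apply: ideal_mul_min.
    split=> [|u v Su Sv|a v Aa Sv] /=; first by rewrite scale0r.
      by rewrite scalerDl; apply: SD.
    by rewrite -scalerA; apply: SZ => //; apply: AB.
  move=> g' z Ig' Jz /=.
  (* Leibniz for gz = (g/f)(fz) gives fz djet(g/f) = jet(gz) - (g/f) jet(fz); multiplying by g'/f
     turns the f on the left into g'. *)
  have -> : g' * z *: djet (g / f) =
      (g' / f) *: (jet (g * z) - (g / f) *: jet (f * z)).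
    have -> : jet (g * z) = jet (g / f * (f * z)) by rewrite mulrA divfK.
    by rewrite [X in X - _]jetM addrC addKr scalerA mulrA divfK.
  apply: (SZ); first exact: Bfrac.
  apply: (submoduleB sB (span_submodule _ _)).
    by apply: Sjet; apply: ideal_mul_in.
  by apply: SZ; [apply: Bfrac|apply: Sjet; apply: ideal_mul_in].
suff EB : forall a, B a -> E a by move=> b y /EB [_ Ea] /Ea.
move=> _ [n [c [Ic ->]]].
elim: n c Ic => [|n IHn] c; first by rewrite expr0 divr1; apply: EA.
move: c; apply: ideal_mul_min.
  split=> [|u v Eu Ev|a v Aa Ev] /=; first by rewrite mul0r; apply: EA; apply: subalg0 sA.
    by rewrite mulrDl; apply: ED.
  by rewrite -mulrA; apply: EM => //; apply: EA.
move=> a b Ia Eb /=; rewrite exprS -mulf_div; apply: EM; first exact: EI.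
exact: IHn.
Qed.

(** As jet(1) = (1, 0, ..., 0), the first column of a jet determinant splits off: its entries are in
    [A], and the complementary minors are determinants of the delta_j(y_i). *)
Lemma wedge_wronskian A : subalgebra A -> wedge_Omega_bar delta A = wronskian A A.
Proof.
move=> sA; have [_ _ SZ] := span_submodule A (jet @` A).
have [W0 WD WM] := gen_submodule A
  [set z | exists y : 'I_r -> K, (forall i, A (y i)) /\
     z = \det (\matrix_(i < r, j < r) (delta j (y i) : K))].
apply/seteqP; split; apply: gen_min (gen_submodule _ _) _; last first.
  move=> _ [v [jv ->]]; rewrite (expand_det_col _ 0).
  apply: submodule_sum (gen_submodule _ _) _ => i _; rewrite mxE.
  have [y Ay yv] := jv i; have /choice[z Az] (s : 'I_r) : exists u, A u /\ jet u = v (lift i s).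
    by have [u] := jv (lift i s); exists u.
  have -> : v i 0 0 = y.
    by rewrite -yv !mxE; case: splitP => // j _; rewrite ord1 mxE eqxx.
  apply: WM => //; rewrite /cofactor -signr_odd.
  set d := \det _; suff Wd : ideal_gen A [set z | exists y : 'I_r -> K, (forall i, A (y i)) /\
     z = \det (\matrix_(i < r, j < r) (delta j (y i) : K))] d.
    case: (odd _); rewrite ?mul1r // mulN1r.
    exact: (submoduleN sA (gen_submodule _ _)).
  apply: sub_gen; exists z; split=> [s|]; first by have [] := Az s.
  congr (\det _); apply/matrixP=> s t; rewrite !mxE.
  have [_ <-] := Az s.
  rewrite !mxE; case: splitP => [j|j /= [tj]]; first by rewrite ord1.
  by rewrite mxE (_ : t = j)//; apply: val_inj.
move=> _ [y [Ay ->]].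
rewrite -gen_detset_span; apply: sub_gen.
(* Conversely, jet(1) bordering the rows djet(y_s) = jet(y_s) - y_s jet(1) gives a block diagonal
   matrix with the same determinant. *)
exists (fun i : 'I_(1 + r) => match fintype.split i with inl _ => jet 1 | inr s => djet (y s) end).
split=> [i|].
  case: (fintype.split i) => [_|s]; first by apply: sub_span; exists 1 => //; apply: subalg1 sA.
  have -> : djet (y s) = jet (y s) - y s *: jet 1.
    by rewrite -[in jet (y s)](mulr1 (y s)) jetM scale1r addrC addKr.
  apply: (submoduleB sA (span_submodule _ _)).
    by apply: sub_span; exists (y s).
  by apply: SZ => //; apply: sub_span; exists 1 => //; apply: subalg1 sA.
set X := \matrix_(i, j) _.
have -> : \det X = \det (block_mx (1%:M : 'M_1) 0 0 X).
  by rewrite det_ublock det1 mul1r.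
have d1 : dvec 1 = 0 by rewrite -(rmorph1 iota) dvec_iota.
congr (\det _); apply/matrixP=> i j; rewrite !mxE; case: splitP => t _.
  by rewrite /jet d1 ord1.
by rewrite /djet !mxE; case: splitP => s _; rewrite !mxE.
Qed.

End Jets.

(** * The operator calJ *)

(** Used to put the rows of a determinant into the increasing order that [calJ_elements]
    requires. *)
Lemma injective_sort (N M : nat) (kappa : 'I_N -> 'I_M) : injective kappa ->
  exists s : 'S_N, forall p q : 'I_N, (p < q)%N -> (kappa (s p) < kappa (s q))%N.
Proof.
move=> kI; pose e := relpre kappa (fun p q : 'I_M => p <= q)%N.
pose l := sort e (enum 'I_N).
have sz : size l = N by rewrite size_sort size_enum_ord.
have ul : uniq l by rewrite sort_uniq enum_uniq.
have sl : sorted e l by apply: sort_sorted => p q; apply: leq_total.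
have g_inj : injective (fun p : 'I_N => nth p l p).
  move=> p q /eqP; rewrite (set_nth_default p) ?sz//.
  by rewrite nth_uniq ?sz// => /eqP /val_inj.
exists (perm g_inj) => p q pq; rewrite !permE ltn_neqAle; apply/andP; split.
  rewrite (inj_eq (inj_comp val_inj kI)) (set_nth_default p) ?sz//.
  by rewrite nth_uniq ?sz// ltn_eqF.
rewrite [nth q _ _](set_nth_default p) ?sz//.
have e_trans : transitive e by move=> a b c; apply: leq_trans.
by apply: (sorted_ltn_nth e_trans p sl) => //; rewrite inE sz.
Qed.

(** Used to find the number a of rows coming from generators of the ideal, once the rows are
    sorted. *)
Lemma initial_segment (N : nat) (P : pred 'I_N) :
  (forall p q : 'I_N, (p < q)%N -> P q -> P p) ->
  exists2 a, (a <= N)%N & forall q : 'I_N, P q = (q < a)%N.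
Proof.
move=> Pd; case: (pickP (fun q => ~~ P q)) => [q0 Pq0|Pall]; last first.
  by exists N => // q; rewrite ltn_ord; move/negbFE: (Pall q).
case: (@arg_minnP _ q0 (fun q => ~~ P q) (@nat_of_ord N) Pq0) => q1 Pq1 q1min; exists q1; first exact: ltnW.
move=> q; case: (ltnP q q1) => [qq1|q1q].
  by apply: contraTT qq1 => /q1min; rewrite -leqNgt.
apply/negbTE; move: q1q; rewrite leq_eqVlt => /orP[/eqP/val_inj <-//|q1q].
by apply: contra Pq1; apply: Pd.
Qed.

Lemma det_castmx_scaled (K : comNzRingType) (a b q : nat) (hab : (a + b = q)%N)
    (X : 'M[K]_(a + b, q)) (c : 'I_b -> K) :
  (\prod_s c s) * \det (castmx (hab, erefl q) X) =
  \det (\matrix_i match fintype.split (cast_ord (esym hab) i) with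
                  | inl s => row (lshift b s) X
                  | inr s => c s *: row (rshift a s) X
                  end).
Proof.
subst q; rewrite castmx_id.
have -> : \prod_s c s = \det (block_mx (1%:M : 'M_a) 0 0 (diag_mx (\row_s c s))).
  by rewrite det_ublock det1 mul1r det_diag; apply: eq_bigr => s _; rewrite mxE.
rewrite -det_mulmx -[X in _ *m X]vsubmxK mul_block_col !mul1mx !mul0mx addr0 add0r.
rewrite mul_diag_mx; congr (\det _); apply/matrixP => i j.
by rewrite !mxE cast_ord_id; case: (fintype.split i) => s; rewrite !mxE.
Qed.

Section CalJ.
Variables (k K : fieldType) (iota : {rmorphism k -> K}).
Variables (r : nat) (delta : 'I_r -> K -> K^o).
Hypothesis dder : forall t, kderivation iota (delta t).
Variables (n : nat) (x : 'I_n -> K) (m : nat) (f : 'I_m.+1 -> K).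
Local Notation R := (algebra_gen iota x).
Local Notation I := (ideal_gen R (range f)).
Local Notation jet := (jet delta).
Local Notation djet := (djet delta).

Lemma algebra_gen_subalgebra : subalgebra iota R.
Proof.
split=> [c M [[Mi _ _]] //|a b Ra Rb M GM|a b Ra Rb M GM];
  have [[_ MD MM] _] := GM; first by apply: MD; [apply: Ra|apply: Rb].
by apply: MM; [apply: Ra|apply: Rb].
Qed.

Lemma algebra_gen_min A : subalgebra iota A -> range x `<=` A -> R `<=` A.
Proof. exact: smallest_sub. Qed.

(** The rows of the matrices defining calJ, each factor f_u being absorbed into one of the rows of
    the x_j. *)
Definition calJ_rows : set 'rV[K]_(1 + r) :=
  [set v | (exists i, v = jet (f i)) \/ (exists u j, v = f u *: djet (x j))].

(** One inclusion is f_u djet(x_j) = jet(x_j f_u) - x_j jet(f_u). For the other, the a in [R] with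
    f_u djet(a) in the span form a subalgebra containing the x_j, and Leibniz then gives the jets of
    all of [I]. *)
Lemma span_calJ_rows : span R (jet @` I) = span R calJ_rows.
Proof.
have sR := algebra_gen_subalgebra.
have Rx j : R (x j) by apply: sub_gen_smallest; exists j.
apply/seteqP; split; apply: span_min (span_submodule _ _) _; last first.
  move=> _ [[i ->]|[u [j ->]]].
    by apply: sub_span; exists (f i) => //; apply: sub_gen; exists i.
  have [S0 SD SZ] := span_submodule R (jet @` I).
  have -> : f u *: djet (x j) = jet (x j * f u) - x j *: jet (f u).
    by rewrite (jetM dder) addrC addKr.
  have If : I (f u) by apply: sub_gen; exists u.
  apply: (submoduleB sR (span_submodule _ _)).
    apply: sub_span; exists (x j * f u) => //.
    by have [_ _ IM] := gen_submodule R (range f); apply: IM.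
  by apply: SZ => //; apply: sub_span; exists (f u).
have [S0 SD SZ] := span_submodule R calJ_rows.
move=> _ [y Iy <-].
suff: I `<=` [set y | span R calJ_rows (jet y) /\
    forall a, R a -> span R calJ_rows (y *: djet a)] by move=> /(_ y Iy) [].
apply: gen_min => [|_ [u _ <-]].
  split=> [|v w [Su Ru] [Sv Rv]|b v Bb [Sv Rv]].
  - by split=> [|a _]; rewrite ?(jet0 dder) ?scale0r.
  - by split=> [|a Ba]; rewrite ?(jetD dder) ?scalerDl; apply: SD; auto.
  - split=> [|a Ba].
      by rewrite (jetM dder); apply: SD; [apply: SZ|apply: Rv].
    by rewrite -scalerA; apply: SZ => //; apply: Rv.
split=> [|a]; first by apply: sub_span; left; exists u.
suff: R `<=` [set a | R a /\ span R calJ_rows (f u *: djet a)] by move=> /[apply] -[].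
have [Ri RD RM] := sR.
apply: algebra_gen_min => [|_ [j _ <-]]; last first.
  by split=> //; apply: sub_span; right; exists u, j.
split=> [c|b c [Rb Sb] [Rc Sc]|b c [Rb Sb] [Rc Sc]]; split; auto.
- by rewrite (djet_iota dder) scaler0.
- by rewrite (djetD dder) scalerDr; apply: SD.
- rewrite (djetM dder) scalerDr !scalerA ![f u * _]mulrC -!scalerA.
  by apply: SD; apply: SZ.
Qed.

Lemma calJ_element_det (a b : nat) (hab : (a + b = 1 + r)%N)
    (u : 'I_b -> 'I_m.+1) (i : 'I_a -> 'I_m.+1) (j : 'I_b -> 'I_n) :
  (\prod_(s < b) f (u s)) *
    \det (castmx (hab, erefl (1 + r)%N)
      (block_mx (\col_(s < a) f (i s))
                (\matrix_(s < a, t < r) (delta t (f (i s)) : K))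
                (0 : 'M[K]_(b, 1))
                (\matrix_(s < b, t < r) (delta t (x (j s)) : K)))) =
  \det (\matrix_q match fintype.split (cast_ord (esym hab) q) with
                  | inl s => jet (f (i s))
                  | inr s => f (u s) *: djet (x (j s))
                  end).
Proof.
rewrite det_castmx_scaled; congr (\det _); apply/row_matrixP => q; rewrite !rowK.
case: (fintype.split _) => s; rewrite ?rowKu ?rowKd row_row_mx.
  by congr row_mx; apply/rowP => t; rewrite !mxE// ord1 eqxx.
by congr (_ *: row_mx _ _); apply/rowP => t; rewrite !mxE.
Qed.

Lemma calJ_elements_sub :
  calJ_elements x delta f `<=` ideal_gen R (detset (span R calJ_rows)).
Proof.
move=> _ [a [b [hab [u [i [j [_ _ ->]]]]]]].
rewrite calJ_element_det; apply: sub_gen; eexists; split=> // q /=.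
apply: sub_span; case: (fintype.split _) => s; first by left; exists (i s).
by right; exists (u s), (j s).
Qed.

(** Arbitrary choices of rows reduce to the increasing ones of [calJ_elements]. The index [kappa q]
    selects one of the f_i or, beyond [m.+1], one of the x_j; [u q] matters only in the second
    case. *)
Lemma calJ_det_in (kappa : 'I_(1 + r) -> 'I_(m.+1 + n)) (u : 'I_(1 + r) -> 'I_m.+1) :
  let row q := match fintype.split (kappa q) with
               | inl i => jet (f i) | inr j => f (u q) *: djet (x j) end in
  ideal_gen R (calJ_elements x delta f) (\det (\matrix_q row q)).
Proof.
move=> row.
have sR := algebra_gen_subalgebra.
pose c q := match fintype.split (kappa q) with inl _ => 1 | inr _ => f (u q) end.
pose G e := match fintype.split e with inl i => jet (f i) | inr j => djet (x j) end.
have rowE q : row q = c q *: G (kappa q).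
  by rewrite /row /c /G; case: (fintype.split _) => // i; rewrite scale1r.
have [kI|] := pselect (injective kappa); last first.
  move=> nkI; have [p [q [kpq pq]]] : exists p q, kappa p = kappa q /\ p != q.
    apply: contrapT => H; apply: nkI => p q kpq; apply/eqP/negPn/negP => pq.
    by apply: H; exists p, q.
  (* Two rows f_u djet(x_j) with the same j may differ in u; after extraction of the factors they
     are equal, and the determinant vanishes. *)
  have -> : \matrix_q row q = diag_mx (\row_q c q) *m \matrix_q G (kappa q).
    by rewrite mul_diag_mx; apply/matrixP => i j; rewrite !mxE rowE !mxE.
  have dG0 : \det (\matrix_q G (kappa q)) = 0.
    by apply: (determinant_alternate pq) => j; rewrite mxE [RHS]mxE kpq.
  by rewrite det_mulmx dG0 mulr0; have [] := gen_submodule R (calJ_elements x delta f).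
have [s sinc] := injective_sort kI.
pose row' q := row (s q).
have -> : \det (\matrix_q row q) = (-1) ^+ s * \det (\matrix_q row' q).
  have -> : \matrix_q row' q = row_perm s (\matrix_q row q).
    by apply/matrixP => i j; rewrite !mxE.
  by rewrite row_permE det_mulmx det_perm mulrA -signr_addb addbb mul1r.
rewrite mulr_sign; suff Jd : ideal_gen R (calJ_elements x delta f) (\det (\matrix_q row' q)).
  by case: (s : bool) => //; apply: (submoduleN sR (gen_submodule _ _)).
apply: sub_gen.
(* After sorting, the rows of the f_i precede those of the x_j, as in the block matrices of the
   definition. *)
pose P q := (kappa (s q) < m.+1)%N.
have [|a aN Pa] := @initial_segment _ P.
  by move=> p q pq; apply: ltn_trans; apply: sinc.
pose b := (1 + r - a)%N; have hab : (a + b = 1 + r)%N by rewrite subnKC.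
have /choice[i iE] (q : 'I_a) : exists i, kappa (s (cast_ord hab (lshift b q))) = lshift n i.
  have : P (cast_ord hab (lshift b q)) by rewrite Pa /= ltn_ord.
  by move=> lt; exists (Ordinal lt); apply: val_inj.
have /choice[j jE] (q : 'I_b) : exists j, kappa (s (cast_ord hab (rshift a q))) = rshift m.+1 j.
  have : ~~ P (cast_ord hab (rshift a q)) by rewrite Pa /= -leqNgt leq_addr.
  rewrite /P; case: (fintype.splitP (kappa (s (cast_ord hab (rshift a q))))) => [//|e ee _].
  by exists e; apply: val_inj.
exists a, b, hab, (fun q => u (s (cast_ord hab (rshift a q)))), i, j; split.
- move=> p q pq; have := sinc (cast_ord hab (lshift b p)) (cast_ord hab (lshift b q)) pq.
  by rewrite !iE.
- move=> p q pq; have := sinc (cast_ord hab (rshift a p)) (cast_ord hab (rshift a q)).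
  by rewrite !jE /= !ltn_add2l; apply.
rewrite calJ_element_det; congr (\det _); apply/row_matrixP => q; rewrite !rowK.
rewrite -[in LHS](cast_ordKV hab q) -[in LHS](splitK (cast_ord _ q)).
case: (fintype.split _) => e /=; rewrite /row' /row.
  by rewrite iE (unsplitK (inl _)).
by rewrite jE (unsplitK (inr _)).
Qed.

(** Both are generated by determinants with rows in one and the same span; in particular calJ
    depends on neither system of generators. *)
Lemma calJ_wronskian : ideal_gen R (calJ_elements x delta f) = wronskian delta R I.
Proof.
rewrite /wronskian -gen_detset_span span_calJ_rows.
apply/seteqP; split; apply: gen_min (gen_submodule _ _) _.
  exact: calJ_elements_sub.
apply: det_span (gen_submodule _ _) _ => _ [v [Sv ->]].
have /choice[ku kuE] q : exists e : 'I_(m.+1 + n) * 'I_m.+1,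
    v q = match fintype.split e.1 with
          | inl i => jet (f i) | inr j => f e.2 *: djet (x j) end.
  have [[i ->]|[u [j ->]]] := Sv q.
    by exists (lshift n i, ord0); rewrite (unsplitK (inl _)).
  by exists (rshift m.+1 j, u); rewrite (unsplitK (inr _)).
have -> : \matrix_q v q = \matrix_q match fintype.split (ku q).1 with
          | inl i => jet (f i) | inr j => f (ku q).2 *: djet (x j) end.
  by apply/matrixP => i j; rewrite !mxE kuE.
exact: (calJ_det_in (fst \o ku) (snd \o ku)).
Qed.

End CalJ.

(** * Polarization *)

Section Polarization.
Variables (k K : fieldType) (iota : {rmorphism k -> K}).
Hypothesis char0 : [pchar k] =i pred0.

Lemma natr_inj_char0 : injective (fun n : nat => n%:R : k).
Proof.
have natr_eq0 := (pcharf0P k).1 char0.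
suff le m n : m%:R = n%:R :> k -> (m <= n)%N.
  by move=> m n E; apply/eqP; rewrite eqn_leq !le.
move=> E; rewrite -subn_eq0 -natr_eq0; have [mn|nm] := leqP m n.
  by rewrite (eqP mn).
by rewrite natrB 1?ltnW// E subrr.
Qed.

(** Interpolation at 0, ..., d-1: these points are distinct in characteristic zero, so the
    Vandermonde matrix is invertible over k and the coefficients are k-combinations of the
    values. *)
Lemma poly_values_coef A (M : set K) (d : nat) (c : 'rV[K]_d) :
  subalgebra iota A -> @submodule K K^o A M ->
  (forall t : nat, M (\sum_j c 0 j * t%:R ^+ j)) -> forall j, M (c 0 j).
Proof.
move=> [Ai _ _] sM Mval j; pose a : 'rV[k]_d := \row_t (t : nat)%:R.
pose V := Vandermonde d a.
have uV : V \in unitmx.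
  rewrite unitmxE det_Vandermonde unitfE; apply/prodf_neq0 => p _.
  apply/prodf_neq0 => q pq; rewrite !mxE subr_eq0.
  by apply: contraTneq pq => /natr_inj_char0 ->; rewrite ltnn.
have -> : c = c *m map_mx iota V *m map_mx iota (invmx V).
  by rewrite -mulmxA -map_mxM mulmxV// map_mx1 mulmx1.
have [_ _ MM] := sM.
rewrite mxE; apply: submodule_sum sM _ => t _; rewrite mulrC mxE.
apply: MM => //; rewrite mxE.
have -> : \sum_l c 0 l * map_mx iota V l t = \sum_l c 0 l * (t : nat)%:R ^+ l.
  by apply: eq_bigr => l _; rewrite !mxE rmorphXn rmorph_nat.
exact: Mval.
Qed.

(** Induction on p: each step trades one factor z for an arbitrary element y1 of [J], which then
    joins the constant b. *)
Lemma polarization A (J M : set K) (p q : nat) (b : K) :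
  subalgebra iota A -> @submodule K K^o A J -> @submodule K K^o A M ->
  (forall z, J z -> M (b * z ^+ (p + q))) ->
  forall y z, ideal_exp A J p y -> J z -> M (b * y * z ^+ q).
Proof.
move=> sA sJ sM; have [_ JD JM] := sJ; have [_ _ MM] := sM; have [Ai _ _] := sA.
elim: p b => [|p IHp] b Mb y z Jy Jz.
  by rewrite -mulrA mulrCA; apply: MM => //; apply: Mb.
move: y Jy; apply: ideal_mul_min.
  have := submodule_preim (b * z ^+ q) sM.
  by congr (submodule _ _); apply/seteqP; split=> y /=; rewrite mulrAC.
move=> y1 y2 Jy1 Jy2 /=; rewrite mulrA; apply: IHp => // {}z {}Jz.
pose N := (p + q)%N.
(* The coefficients in t of b (z + t y1)^(N+1). The linear one is (N+1) b y1 z^N, and N+1 is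
   invertible in k. *)
pose c : 'rV[K]_N.+2 := \row_i (b * (z ^+ (N.+1 - i) * y1 ^+ i *+ 'C(N.+1, i))).
have Mc : M (c 0 (inord 1)).
  apply: (poly_values_coef sA sM) => t.
  have Jt : J (z + t%:R * y1).
    by apply: JD => //; apply: JM => //; rewrite -(rmorph_nat iota).
  have := Mb _ Jt; rewrite addSn -/N exprDn mulr_sumr.
  congr (M _); apply: eq_bigr => i _; rewrite mxE exprMn -mulrA.
  by congr (_ * _); rewrite mulrnAl -mulrA [_ * y1 ^+ i]mulrC.
move: Mc; rewrite mxE inordK// subn1 /= expr1 bin1 => Mc.
have -> : b * y1 * z ^+ N = iota (N.+1%:R^-1) * (b * (z ^+ N * y1 *+ N.+1)).
  rewrite fmorphV rmorph_nat -[_ * y1 *+ _]mulr_natl [b * (_ * _)]mulrCA mulKf.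
    by rewrite -mulrA [y1 * _]mulrC.
  by rewrite -(rmorph_nat iota) fmorph_eq0 ((pcharf0P k).1 char0).
exact: MM.
Qed.

End Polarization.

(** * Local membership *)

Section Krull.
Variables (k K : fieldType) (iota : {rmorphism k -> K}).
Variable A : set K.
Hypothesis sA : subalgebra iota A.

Lemma maximal_ideal_above (Q : set K) : ideal A Q -> ~ Q 1 ->
  exists P, [/\ ideal A P, ~ P 1, Q `<=` P &
    forall N, ideal A N -> P `<=` N -> ~ N 1 -> N `<=` P].
Proof.
move=> iQ Q1; have [QA [Q0 QD QM]] := iQ.
(* Taking the union with [Q] makes the condition hold for the union of the empty chain as well. *)
pose proper (X : set K) := ideal A (X `|` Q) /\ ~ (X `|` Q) 1.
have [|P [[iP P1] Pmax]] := @Zorn_bigcup K proper.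
  move=> F Fproper Ftot.
  have FD X u v : F X -> X u -> Q v -> (X `|` Q) (u + v).
    move=> FX Xu Qv; have [[_ [_ XD _]] _] := Fproper X FX.
    by apply: XD; [left|right].
  split; last first.
    by move=> [[X FX X1]|//]; have [_] := Fproper X FX; apply; left.
  split; first by move=> u [[X FX Xu]|/QA//]; have [[XA _] _] := Fproper X FX; apply: XA; left.
  have inF X u : F X -> (X `|` Q) u -> (\bigcup_(X in F) X `|` Q) u.
    by move=> FX [Xu|Qu]; [left; exists X|right].
  split=> [|u v|a v Aa]; first by right.
  - case=> [[X FX Xu]|Qu] [[Y FY Yv]|Qv].
    + have [XY|YX] := Ftot X Y FX FY.
        have [[_ [_ YD _]] _] := Fproper Y FY.
        by apply: (inF Y) => //; apply: YD; left=> //; apply: XY.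
      have [[_ [_ XD _]] _] := Fproper X FX.
      by apply: (inF X) => //; apply: XD; left=> //; apply: YX.
    + by apply: (inF X) => //; apply: FD.
    + by apply: (inF Y) => //; rewrite addrC; apply: FD.
    + by right; apply: QD.
  - case=> [[X FX Xv]|Qv]; last by right; apply: QM.
    have [[_ [_ _ XM]] _] := Fproper X FX.
    by apply: (inF X) => //; apply: XM => //; left.
exists (P `|` Q); split=> // N iN PN N1 u Nu; apply: contrapT => PQu.
apply: (Pmax N).
  split; first by move=> v Pv; apply: PN; left.
  by move=> NP; apply: PQu; left; apply: NP.
rewrite /proper; have -> : N `|` Q = N by apply/setUidPl => v Qv; apply: PN; right.
by split.
Qed.

Lemma maximal_ideal_prime (P : set K) : ideal A P -> ~ P 1 ->
  (forall N, ideal A N -> P `<=` N -> ~ N 1 -> N `<=` P) -> prime_ideal A P.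
Proof.
move=> iP P1 Pmax; have [PA [P0 PD PM]] := iP; have [_ AD AM] := sA.
split=> // a b Aa Ab Pab; have [Pa|nPa] := pselect (P a); [by left|right].
pose N := [set z | exists p c, [/\ P p, A c & z = p + c * a]].
have [[p [c [Pp Ac E]]]|N1] := pselect (N 1).
  by rewrite -[b]mul1r E mulrDl -mulrA mulrC; apply: PD; apply: PM.
case: nPa; apply: (Pmax N) => //.
- split=> [_ [p [c [Pp Ac ->]]]|]; first by apply: AD; [apply: PA|apply: AM].
  split=> [|_ _ [p [c [Pp Ac ->]]] [q [d [Pq Ad ->]]]|e _ Ae [p [c [Pp Ac ->]]]].
  + by exists 0, 0; split=> //; [apply: subalg0 sA|rewrite mul0r addr0].
  + by exists (p + q), (c + d); split; [apply: PD|apply: AD|rewrite mulrDl addrACA].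
  + exists (e * p), (e * c); split; [exact: PM|exact: AM|].
    by rewrite /GRing.scale /= mulrDr mulrA.
- by move=> p Pp; exists p, 0; split=> //; [apply: subalg0 sA|rewrite mul0r addr0].
- by exists 0, 1; split=> //; [apply: subalg1 sA|rewrite mul1r add0r].
Qed.

(** If the ideal of all a with ay in [M] were proper, it would lie in a maximal ideal, which is
    prime and so misses some g with gy in [M]. *)
Lemma submodule_local (M : set K) (y : K) : @submodule K K^o A M ->
  (forall P, prime_ideal A P -> exists g, [/\ A g, ~ P g & M (g * y)]) -> M y.
Proof.
move=> sM Mloc; have [M0 MD MM] := sM; have [_ AD AM] := sA.
pose Q := [set a | A a /\ M (a * y)].
have iQ : ideal A Q.
  split=> [a []//|]; split=> [|a b [Aa Ma] [Ab Mb]|a b Aa [Ab Mb]].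
  - by split; [apply: subalg0 sA|rewrite mul0r].
  - by split; [apply: AD|rewrite mulrDl; apply: MD].
  - by split; [apply: AM|rewrite -mulrA; apply: MM].
have [[_ ]|Q1] := pselect (Q 1); first by rewrite mul1r.
have [P [iP P1 QP Pmax]] := maximal_ideal_above iQ Q1.
have [g [Ag nPg Mg]] := Mloc P (maximal_ideal_prime iP P1 Pmax).
by case: nPg; apply: QP.
Qed.

End Krull.

(** * Local freeness of the differentials *)

Section DetSubalgebra.
Variables (k K : fieldType) (iota : {rmorphism k -> K}).

Lemma det_subalgebra A (p : nat) (C : 'M[K]_p) : subalgebra iota A ->
  (forall i j, A (C i j)) -> A (\det C).
Proof.
move=> sA AC; have [_ AD AM] := sA.
apply: submodule_sum (subalg_submodule sA) _ => s _; apply: (AM).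
  by rewrite -signr_odd; case: odd; [apply: (subalgN sA)|rewrite expr0]; apply: (subalg1 sA).
by elim/big_ind: _ => [|a b|i _]; [exact: (subalg1 sA)|exact: AM|exact: AC].
Qed.

Lemma common_denominator A (p : nat) (u : 'rV[K]_p) : subalgebra iota A ->
  fraction_field_of A ->
  exists d, [/\ A d, d != 0 & forall i, A (d * u 0 i)].
Proof.
move=> sA fA; have [_ _ AM] := sA.
have /choice[d dP] i : exists d, [/\ A d, d != 0 & A (d * u 0 i)].
  have [a [b [Aa Ab b0 ->]]] := fA (u 0 i).
  by exists b; split=> //; rewrite mulrC divfK.
have Aprod (P : pred 'I_p) : A (\prod_(i | P i) d i).
  elim/big_ind: _ => //; first exact: subalg1 sA.
  by move=> i _; have [] := dP i.
exists (\prod_i d i); split=> // [|i].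
  by apply/prodf_neq0 => i _; have [] := dP i.
by rewrite (bigD1 i)//= mulrAC mulrC; apply: AM => //; have [] := dP i.
Qed.

Lemma ideal_exp_subalg A n : subalgebra iota A -> ideal_exp A A n = A.
Proof.
by move=> sA; elim: n => //= n ->; rewrite (ideal_mul1 sA)//; apply: (subalg_submodule sA).
Qed.

(** A localization is a chart of the blowup of the unit ideal, so the results on charts apply to
    it. *)
Lemma localization_chart A g : subalgebra iota A -> g != 0 ->
  @localization K K^o g A = blowup_chart A A g.
Proof.
move=> sA g0; apply/seteqP; split=> [z [n Agz]|_ [n [c [Ac ->]]]]; exists n.
  exists (g ^+ n * z); rewrite ideal_exp_subalg//.
  by split=> //; rewrite [_ * z]mulrC mulfK ?expf_neq0.
by rewrite ideal_exp_subalg// in Ac; rewrite /GRing.scale /= mulrC divfK ?expf_neq0.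
Qed.

End DetSubalgebra.

Section LocallyFree.
Variables (k K : fieldType) (iota : {rmorphism k -> K}).
Variables (L : set (K -> K^o)) (Lfol : foliation iota L).
Variables (r : nat) (delta : 'I_r -> K -> K^o).
Hypothesis deltabasis : is_basis setT L delta.
Variable A : set K.
Hypotheses (sA : subalgebra iota A) (fA : fraction_field_of A).
Local Notation dvec := (dvec delta).
Local Notation Omega := (Omega_bar L A).
Local Notation wedge := (wedge_Omega_bar delta A).

Definition foliation_basis_elt (t : 'I_r) : L :=
  exist _ (delta t) (mem_set (deltabasis.1 t)).
Local Notation dL := foliation_basis_elt.

(** Linearity in coordinates: [L -> K^o] consists of all functions, and only the linear ones are
    determined by their values on the basis. *)
Definition basis_linear (v : L -> K^o) : Prop :=
  forall (d : L) (c : 'rV[K]_r), set_val d = \sum_t c 0 t *: delta t ->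
    v d = \sum_t c 0 t * (v (dL t) : K).

Definition basis_values (v : L -> K^o) : 'rV[K]_r := \row_t (v (dL t) : K).

Lemma basis_values_diff a : basis_values (diff L a) = dvec a.
Proof. by apply/rowP => t; rewrite !mxE. Qed.

Lemma basis_valuesD v w : basis_values (v + w) = basis_values v + basis_values w.
Proof. by apply/rowP => t; rewrite !mxE. Qed.

Lemma basis_valuesZ c v : basis_values (c *: v) = c *: basis_values v.
Proof. by apply/rowP => t; rewrite !mxE. Qed.

Lemma basis_values0 : basis_values 0 = 0.
Proof. by apply/rowP => t; rewrite !mxE. Qed.

Lemma basis_values_sum s (c : 'rV[K]_s) (e : 'I_s -> L -> K^o) :
  basis_values (\sum_i c 0 i *: e i) = c *m \matrix_i basis_values (e i).
Proof.
rewrite mulmx_sum_row (big_morph _ basis_valuesD basis_values0).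
by apply: eq_bigr => i _; rewrite rowK basis_valuesZ.
Qed.

Lemma basis_linear_submodule : submodule setT basis_linear.
Proof.
split=> [d c _|u v lu lv d c E|a v _ lv d c E].
- by rewrite big1// => t _; rewrite mulr0.
- rewrite [LHS](congr2 +%R (lu d c E) (lv d c E)) -big_split.
  by apply: eq_bigr => t _; rewrite mulrDr.
- rewrite [LHS](congr1 ( *%R a) (lv d c E)) mulr_sumr.
  by apply: eq_bigr => t _; rewrite mulrCA.
Qed.

Lemma basis_linear_diff a : basis_linear (diff L a).
Proof.
move=> d c E; rewrite /diff E fct_sumE.
by apply: eq_bigr.
Qed.

Lemma Omega_linear v : Omega v -> basis_linear v.
Proof.
move: v; apply: span_min; first exact: submoduleW (@subsetT _ _) basis_linear_submodule.
by move=> _ [a _ <-]; apply: basis_linear_diff.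
Qed.

Lemma localization_linear g v : g != 0 -> localization g Omega v -> basis_linear v.
Proof.
move=> g0 [n Ov]; have [_ _ lZ] := basis_linear_submodule.
by rewrite -[v](scalerK (expf_neq0 n g0)); apply: lZ => //; apply: Omega_linear.
Qed.

Lemma basis_values_inj v w : basis_linear v -> basis_linear w ->
  basis_values v = basis_values w -> v = w.
Proof.
move=> lv lw E; apply/funext => d.
have [|c [[_ Ed] _]] := deltabasis.2 (set_val d); first exact: set_valP.
rewrite (lv d c)// (lw d c)//; apply: eq_bigr => t _; congr (_ * _).
by move/rowP/(_ t): E; rewrite !mxE.
Qed.

Lemma basis_der t : kderivation iota (delta t).
Proof. by case: Lfol => Lder _ _; apply/Lder/deltabasis.1. Qed.

(** The derivation with coordinates c vanishes on [A], hence on its fraction field by Leibniz, so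
    its coordinates are zero. *)
Lemma basis_independent (c : 'cV[K]_r) :
  (forall a, A a -> dvec a *m c = 0) -> c = 0.
Proof.
move=> Ac; pose d y := \sum_t c t 0 * (delta t y : K).
have dA a : A a -> d a = 0.
  move=> /Ac /matrixP/(_ 0 0); rewrite !mxE => E; rewrite -[RHS]E.
  by apply: eq_bigr => t _; rewrite !mxE mulrC.
have dM y z : d (y * z) = d y * z + y * d z.
  rewrite mulr_suml mulr_sumr -big_split; apply: eq_bigr => t _ /=.
  by case: (basis_der t) => _ -> _; rewrite mulrDr mulrA mulrCA.
have d0 y : d y = 0.
  have [a [b [Aa Ab b0 ->]]] := fA y.
  have := dM (a / b) b; rewrite divfK// dA// (dA b)// mulr0 addr0 => /esym/eqP.
  by rewrite mulf_eq0 (negPf b0) orbF => /eqP.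
have [L0 _ _] : submodule setT L by case: Lfol.
have [e [_ eU]] := deltabasis.2 0 L0.
have e0 : e = 0.
  apply: eU; split=> //; rewrite big1// => t _; rewrite mxE; exact: scale0r.
have ec : e = c^T.
  apply: eU; split=> //; apply/funext => y; rewrite fct_sumE.
  rewrite -[LHS](d0 y); apply: eq_bigr => t _; by rewrite mxE.
by rewrite -[c]trmxK -ec e0 trmx0.
Qed.

Lemma wedge_detset : wedge = ideal_gen A (detset (dvec @` A)).
Proof.
congr ideal_gen; apply/seteqP; split=> [_ [y [Ay ->]]|_ [v [Av ->]]].
  exists (dvec \o y); split=> [i|]; first by exists (y i).
  by congr (\det _); apply/matrixP => i j; rewrite !mxE.
have /choice[y yP] i : exists a, A a /\ dvec a = v i by have [a] := Av i; exists a.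
exists y; split=> [i|]; first by have [] := yP i.
congr (\det _); apply/matrixP => i j; rewrite !mxE.
by have [_ <-] := yP i; rewrite mxE.
Qed.

(** The generator h is the determinant of the values of a local basis of differentials on the
    delta_j. *)
Lemma free_wedge_principal g : A g -> g != 0 ->
  free_module (@localization K K^o g A) (localization g Omega) ->
  exists h, [/\ h != 0, exists n, wedge (g ^+ n * h) &
    forall z, wedge z -> @localization K K^o g A (z / h)].
Proof.
move=> Ag g0 [s [e [Oe ebasis]]]; have [_ AD AM] := sA.
rewrite (localization_chart sA g0) in ebasis *.
have sAg : subalgebra iota (blowup_chart A A g).
  by apply: chart_subalgebra => //; apply: subalg_submodule sA.
have AAg : A `<=` blowup_chart A A g by apply: sub_chart.
have [O0 OD OZ] := span_submodule A (diff L @` A).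
have Odiff a : A a -> Omega (diff L a) by move=> Aa; apply: sub_span; exists a.
have le i : basis_linear (e i) by apply: localization_linear g0 (Oe i).
pose E := \matrix_i basis_values (e i).
have diffE a : A a -> exists2 c : 'rV[K]_s,
    forall i, blowup_chart A A g (c 0 i) & dvec a = c *m E.
  move=> Aa; have [|c [[Ac Ec] _]] := ebasis (diff L a).
    by exists 0%N; rewrite expr0 scale1r; apply: Odiff.
  by exists c => //; rewrite -basis_values_sum -Ec basis_values_diff.
(* A relation over [K] between the rows becomes one over [A] after clearing denominators, against
   uniqueness of coordinates. *)
have freeE : row_free E.
  apply: inj_row_free => u uE.
  have [d [Ad d0 Adu]] := common_denominator u sA fA.
  have [|c [_ cU]] := ebasis 0; first by exists 0%N; rewrite scaler0.
  have c0 : c = 0.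
    apply: cU; split=> [i|]; first by rewrite mxE; apply: (subalg0 sAg).
    by rewrite big1// => i _; rewrite mxE scale0r.
  have cdu : c = d *: u.
    apply: cU; split=> [i|]; first by rewrite mxE; apply: AAg.
    have [l0 _ lZ] := basis_linear_submodule.
    apply: basis_values_inj => //.
      by apply: submodule_sum basis_linear_submodule _ => i _; apply: lZ.
    by rewrite basis_values0 basis_values_sum -/E -scalemxAl uE scaler0.
  by apply: (scalerI d0); rewrite -cdu c0 scaler0.
(* A column vector killed by [E] is killed by all differentials, so it is zero. Together with
   freeness this forces s = r. *)
have fullE : row_full E.
  rewrite /row_full -mxrank_tr; apply: inj_row_free => w wE.
  rewrite -[w]trmxK [w^T]basis_independent ?trmx0// => a /diffE[c _ ->].
  by rewrite -mulmxA -[E]trmxK -trmx_mul wE trmx0 mulmx0.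
have sr : s = r by move: freeE fullE; rewrite /row_free /row_full => /eqP -> /eqP.
subst s; exists (\det E); split.
- by rewrite -unitfE -unitmxE -row_free_unit.
- have /choice[N_ NP] i : exists n, Omega (g ^+ n *: e i) by apply: Oe.
  (* One power g^N brings all r basis elements into the differentials of [A]; the determinant then
     acquires g^(N r). *)
  pose N := \max_i N_ i; exists (N * r)%N; rewrite exprM -detZ.
  have -> : g ^+ N *: E = \matrix_i basis_values (g ^+ N *: e i).
    by apply/row_matrixP => i; rewrite linearZ /= !rowK basis_valuesZ.
  rewrite wedge_detset -gen_detset_span; apply: sub_gen.
  exists (fun i => basis_values (g ^+ N *: e i)); split=> // i.
  have : Omega (g ^+ N *: e i).
    rewrite -(subnK (leq_bigmax i : N_ i <= N)%N) exprD -scalerA; apply: OZ; last exact: NP.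
    by rewrite -(ideal_exp_subalg (N - N_ i) sA); apply: (ideal_exp_expr _ sA).
  have [S0 SD SZ] := span_submodule A (dvec @` A).
  suff: Omega `<=` [set v | span A (dvec @` A) (basis_values v)] by apply.
  apply: span_min.
    split=> [|u v Su Sv|a v Aa Sv] /=; first by rewrite basis_values0.
      by rewrite basis_valuesD; apply: SD.
    by rewrite basis_valuesZ; apply: SZ.
  by move=> _ [a Aa <-]; rewrite /= basis_values_diff; apply: sub_span; exists a.
- have [_ BD BM] := sAg.
  rewrite wedge_detset; apply: gen_min.
    split=> [|u v Bu Bv|a v Aa Bv] /=; first by rewrite mul0r; apply: (subalg0 sAg).
      by rewrite mulrDl; apply: BD.
    by rewrite -mulrA; apply: BM => //; apply: AAg.
  move=> _ [v [vA ->]] /=.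
  have /choice[C CP] i : exists c : 'rV[K]_r,
      (forall j, blowup_chart A A g (c 0 j)) /\ v i = c *m E.
    by have [a /diffE[c Bc ->] <-] := vA i; exists c.
  have -> : \matrix_i v i = (\matrix_i C i) *m E.
    by apply/row_matrixP => i; rewrite row_mul !rowK; have [] := CP i.
  rewrite det_mulmx mulfK; last by rewrite -unitfE -unitmxE -row_free_unit.
  by apply: det_subalgebra sAg _ => i j; rewrite mxE; have [] := CP i.
Qed.

(** Cramer's rule, by expansion along the replaced row. *)
Lemma adj_row_det (Y : 'M[K]_r) (u : 'rV[K]_r) i :
  (u *m \adj Y) 0 i = \det (\matrix_j (if j == i then u else row j Y)).
Proof.
rewrite (expand_det_row _ i) mxE; apply: eq_bigr => j _.
rewrite !mxE eqxx; congr (_ * (_ * \det _)); apply/matrixP => p q.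
by rewrite !mxE eq_sym (negPf (neq_lift _ _)) mxE.
Qed.

Lemma principal_locally_free h : h != 0 -> wedge = scaled h A ->
  locally_free A Omega.
Proof.
move=> h0 wedgeE P Pprime; have [[PA sP] P1 _] := Pprime.
(* If all the determinants divided by h were in [P], then [wedge] would lie in hP, whereas it
   contains h. *)
have [y [Ay Py]] : exists y : 'I_r -> K,
    (forall i, A (y i)) /\ ~ P (h^-1 * \det (\matrix_i dvec (y i))).
  apply: contrapT => H; apply: P1.
  have : scaled h P h.
    suff: wedge `<=` scaled h P.
      by apply; rewrite wedgeE; exists 1; rewrite ?mulr1//; apply: (subalg1 sA).
    rewrite wedge_detset; apply: gen_min; first exact: scaled_submodule.
    move=> _ [v [vA ->]].
    have /choice[y yP] i : exists a, A a /\ dvec a = v i.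
      by have [a] := vA i; exists a.
    apply/scaledP => //; apply: contrapT => nP; apply: H; exists y.
    split=> [i|]; first by have [] := yP i.
    suff -> : \matrix_i dvec (y i) = \matrix_i v i by [].
    by apply/row_matrixP => i; rewrite !rowK; have [] := yP i.
  by move/(scaledP _ _ h0); rewrite mulVf.
set Y := \matrix_i dvec (y i) in Py; set g := h^-1 * \det Y in Py.
have wedge_det (v : 'I_r -> 'rV[K]_r) : (forall i, (dvec @` A) (v i)) ->
    A (h^-1 * \det (\matrix_i v i)).
  move=> vA; apply/(scaledP _ _ h0); rewrite -wedgeE wedge_detset.
  by apply: sub_gen; exists v.
have Ag : A g by apply: wedge_det => i; exists (y i).
have g0 : g != 0 by apply: contra_notN Py => /eqP ->; case: sP.
have Yg : \det Y = h * g by rewrite mulVKf.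
have uY : Y \in unitmx by rewrite unitmxE unitfE Yg mulf_neq0.
exists g; split=> //; rewrite (localization_chart sA g0).
have sAA := subalg_submodule sA.
set B := blowup_chart A A g.
have sB : subalgebra iota B by apply: chart_subalgebra.
have [_ BD BM] := sB.
have AB : A `<=` B by apply: sub_chart.
have [O0 OD OZ] := span_submodule A (diff L @` A).
exists r, (fun i => diff L (y i)).
have comb_linear (c : 'rV[K]_r) : basis_linear (\sum_i c 0 i *: diff L (y i)).
  have [_ _ lZ] := basis_linear_submodule.
  apply: submodule_sum basis_linear_submodule _ => i _; apply: lZ => //.
  exact: basis_linear_diff.
have comb_values (c : 'rV[K]_r) :
    basis_values (\sum_i c 0 i *: diff L (y i)) = c *m Y by exact: basis_values_sum.
split=> [i|v [n Ov]].
  by exists 0%N; rewrite expr0 scale1r; apply: sub_span; exists (y i).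
have OmegaB w : Omega w -> exists c : 'rV[K]_r,
    (forall i, B (c 0 i)) /\ w = \sum_i c 0 i *: diff L (y i).
  move: w; apply: span_min.
    split=> [|u w [c [Bc ->]] [d [Bd ->]]|a w Aa [c [Bc ->]]].
    - exists 0; split=> [i|]; first by rewrite mxE; apply: (subalg0 sB).
      by rewrite big1// => i _; rewrite mxE scale0r.
    - exists (c + d); split=> [i|]; first by rewrite mxE; apply: BD.
      by rewrite -big_split; apply: eq_bigr => i _; rewrite mxE scalerDl.
    - exists (a *: c); split=> [i|]; first by rewrite mxE; apply: BM => //; apply: AB.
      by rewrite scaler_sumr; apply: eq_bigr => i _; rewrite mxE scalerA.
  move=> _ [a Aa <-]; exists (dvec a *m invmx Y); split=> [i|]; last first.
    apply: basis_values_inj => //; first exact: basis_linear_diff.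
    by rewrite comb_values basis_values_diff mulmxKV.
  (* The coordinates of da in the dy_i are determinants of differentials divided by det Y = hg. Such
     determinants lie in hA, so only g remains in the denominator. *)
  rewrite /invmx uY -scalemxAr mxE adj_row_det Yg invfM mulrC mulrA [_ * h^-1]mulrC.
  apply: (chart_frac g sA sAA); apply: wedge_det => j.
  by case: eqP => _; [exists a|rewrite rowK; exists (y j)].
have [c [Bc Ec]] := OmegaB _ Ov.
have gB : B (g ^+ n)^-1.
  by exists n, 1; split; [rewrite (ideal_exp_subalg n sA); apply: (subalg1 sA)|rewrite mul1r].
exists ((g ^+ n)^-1 *: c); split.
  split=> [i|]; first by rewrite mxE; apply: BM.
  rewrite -[LHS](scalerK (expf_neq0 n g0)) Ec scaler_sumr.
  by apply: eq_bigr => i _; rewrite mxE scalerA.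
move=> d [_ Ed]; apply: (can_inj (mulmxK uY)); rewrite -!comb_values -Ed.
congr basis_values; rewrite -[RHS](scalerK (expf_neq0 n g0)) Ec scaler_sumr.
by apply: eq_bigr => i _; rewrite mxE scalerA.
Qed.

End LocallyFree.

(** * Powers of a finitely generated ideal *)

Section PowersOfIdeals.
Variables (k K : fieldType) (iota : {rmorphism k -> K}).
Variables (R : set K) (m : nat) (f : 'I_m.+1 -> K).
Hypothesis sR : subalgebra iota R.
Local Notation I := (ideal_gen R (range f)).

Lemma monomial_ideal_exp (e : 'I_m.+1 -> nat) :
  ideal_exp R I (\sum_i e i) (\prod_i f i ^+ e i).
Proof.
elim/big_rec2: _ => [|i d y _ Iy]; first exact: (subalg1 sR).
apply: (ideal_exp_in sR) => //; apply: (ideal_exp_expr _ sR).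
by apply: sub_gen; exists i.
Qed.

Lemma ideal_exp_monomials N : ideal_exp R I N `<=`
  ideal_gen R [set \prod_i f i ^+ e i | e in [set e | \sum_i e i = N]].
Proof.
elim: N => [|N IHN].
  move=> a Ra; rewrite -[a]mulr1.
  have [_ _ GM] := gen_submodule R
    [set \prod_i f i ^+ e i | e in [set e | \sum_i e i = 0%N]].
  apply: GM => //; apply: sub_gen; exists (fun=> 0%N); rewrite /= big1//.
set G := ideal_gen R _ in IHN *; rewrite /= ideal_mul_genl//.
apply: ideal_mul_min; first exact: gen_submodule.
move=> _ b [i _ <-] /IHN; move: b; apply: gen_min.
  exact/submodule_preim/gen_submodule.
move=> _ [e eN <-]; apply: sub_gen.
exists (fun j => (j == i) + e j)%N.
  by rewrite /= big_split -big_mkcond /= big_pred1_eq eN.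
rewrite (bigD1 i)//= eqxx exprS -mulrA; congr (_ * _).
by rewrite [RHS](bigD1 i)//=; congr (_ * _); apply: eq_bigr => j /negPf ->.
Qed.

(* By pigeonhole every monomial of degree (m+1)n in the m+1 generators is     *)
(* divisible by the n-th power of one of them.                                *)
Lemma ideal_exp_absorb (J : set K) (y : K) n :
  (forall i, ideal_mul R (ideal_exp R I n) J (f i ^+ n * y)) ->
  forall a, ideal_exp R I (m.+1 * n) a ->
    ideal_mul R (ideal_exp R I (m.+1 * n)) J (a * y).
Proof.
move=> Hy a /ideal_exp_monomials.
have sE := ideal_mul_submodule R (ideal_exp R I (m.+1 * n)) J.
move: a; apply: gen_min.
  have := submodule_preim y sE.
  by congr (submodule _ _); apply/seteqP; split=> b /=; rewrite mulrC.
move=> _ [e /= eN <-].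
have [i ni] : exists i, (n <= e i)%N.
  apply: contrapT => H; have lt i : (e i < n)%N.
    by rewrite ltnNge; apply/negP => ni; apply: H; exists i.
  have : (\sum_(i < m.+1) e i < \sum_(i < m.+1) n)%N.
    rewrite (bigD1 ord0)//= [ltnRHS](bigD1 ord0)//= -addSn.
    by apply: leq_add => //; apply: leq_sum => i _; apply: ltnW.
  by rewrite eN sum_nat_const card_ord ltnn.
(* The exponents left after removing f_i^n; the complementary monomial has degree (m+1)n - n. *)
pose e' j := (e j - (j == i) * n)%N.
have -> : \prod_j f j ^+ e j = \prod_j f j ^+ e' j * f i ^+ n.
  rewrite (bigD1 i)//= [in RHS](bigD1 i)//= /e' eqxx mul1n mulrAC -exprD subnK//.
  by congr (_ * _); apply: eq_bigr => j /negPf ->; rewrite mul0n subn0.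
have e'N : (\sum_j e' j + n = m.+1 * n)%N.
  rewrite -eN (bigD1 i)//= [in RHS](bigD1 i)//= /e' eqxx mul1n addnAC subnK//.
  by congr (_ + _)%N; apply: eq_bigr => j /negPf ->; rewrite mul0n subn0.
rewrite -mulrA -e'N -(ideal_expD _ _ _ sR) -ideal_mulA.
by apply: ideal_mul_in => //; apply: monomial_ideal_exp.
Qed.

Lemma ideal_mul_exp_up (J : set K) (y a : K) n N : I a -> (n <= N)%N ->
  ideal_mul R (ideal_exp R I n) J (a ^+ n * y) ->
  ideal_mul R (ideal_exp R I N) J (a ^+ N * y).
Proof.
move=> Ia nN Hy; rewrite -(subnK nN) exprD -mulrA -(ideal_expD _ _ _ sR) -ideal_mulA.
by apply: ideal_mul_in => //; apply: (ideal_exp_expr _ sR).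
Qed.

(** Passes from the charts back to [R]: the exponents depend on the chart and on the element, and
    finiteness of both families of generators gives a uniform one. *)
Lemma ideal_exp_absorb_fin (J : set K) (F : finType) (d : F -> K) :
  (forall i y, ideal_gen R (range d) y -> 
     exists n, ideal_mul R (ideal_exp R I n) J (f i ^+ n * y)) ->
  exists N, ideal_mul R (ideal_exp R I N) (ideal_gen R (range d)) `<=`
            ideal_mul R (ideal_exp R I N) J.
Proof.
move=> Hd.
have /choice[n_ nP] (p : 'I_m.+1 * F) :
    exists n, ideal_mul R (ideal_exp R I n) J (f p.1 ^+ n * d p.2).
  by apply: Hd; apply: sub_gen; exists p.2.
pose n := \max_p n_ p; exists (m.+1 * n)%N.
rewrite ideal_mul_genr//; apply: ideal_mul_min; first exact: ideal_mul_submodule.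
move=> a _ Ia [q _ <-]; apply: ideal_exp_absorb => // i.
apply: (ideal_mul_exp_up _ (leq_bigmax (i, q)) (nP (i, q))).
by apply: sub_gen; exists i.
Qed.

End PowersOfIdeals.

(** * Extension to the charts of a blowup *)

Section WronskianOnCharts.
Variables (k K : fieldType) (iota : {rmorphism k -> K}).
Variables (r : nat) (delta : 'I_r -> K -> K^o).
Hypothesis dder : forall t, kderivation iota (delta t).
Local Notation wronskian := (wronskian delta).

Lemma wronskian_exp (A X Y : set K) : [pchar k] =i pred0 ->
  subalgebra iota A -> @submodule K K^o A Y ->
  ideal_mul A (ideal_exp A Y r.+1) (wronskian A X) `<=`
  wronskian A (ideal_mul A X Y).
Proof.
move=> char0 sA sY; have sW := wronskian_submodule delta A (ideal_mul A X Y).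
apply: ideal_mul_min => // y d Yy Wd.
have [Y0 _ _] := sY.
(* Polarization is used with q = 0, so the remaining variable is irrelevant: it is set to 0, and 0^0
   = 1. *)
suff: wronskian A (ideal_mul A X Y) (d * y * 0 ^+ 0) by rewrite mulr1 mulrC.
apply: (polarization char0 sA sY sW) Yy Y0 => z Yz; rewrite addn0.
have : scaled (z ^+ r.+1) (wronskian A X) (z ^+ r.+1 * d) by exists d.
rewrite -(wronskian_scaled dder) mulrC; apply: wronskian_mono.
by move=> _ [a Xa <-]; rewrite mulrC; apply: ideal_mul_in.
Qed.

Lemma wronskian_self_ext (A I : set K) (f : K) : subalgebra iota A ->
  @submodule K K^o A I -> I f -> f != 0 -> let B := blowup_chart A I f in
  ideal_gen B (wronskian A I) = scaled (f ^+ r.+1) (wronskian B B).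
Proof.
move=> sA sI If f0 B.
have genB : ideal_gen B I = scaled f B := gen_chart sA sI If f0.
have /= := wronskian_chart dder A sA sI If f0.
by rewrite ideal_mulC (ideal_mul1 sA sI) -/B genB (wronskian_scaled dder).
Qed.

(** On the chart I W_A(I) becomes f^(r+2) w, and taking W raises the factor to the power r+1. For n
    = r+2 the factor in [wronskian_exp_ext] is the same. *)
Lemma wronskian_mul_ext (A I : set K) (f : K) : subalgebra iota A ->
  @submodule K K^o A I -> I f -> f != 0 ->
  let B := blowup_chart A I f in let w := wronskian B B in
  ideal_gen B (wronskian A (ideal_mul A I (wronskian A I))) =
  scaled ((f ^+ r.+1) ^+ r.+2) (wronskian B w).
Proof.
move=> sA sI If f0 B w.
have AB : A `<=` B by apply: sub_chart.
have sB : subalgebra iota B by apply: chart_subalgebra.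
have genB : ideal_gen B I = scaled f B := gen_chart sA sI If f0.
have genW : ideal_gen B (wronskian A I) = _ := wronskian_self_ext sA sI If f0.
rewrite -(wronskian_chart dder (wronskian A I) sA sI If f0) -/B.
rewrite gen_ideal_mul// genB genW.
rewrite ideal_mul_scaled (ideal_mul1 sB); last exact: wronskian_submodule.
by rewrite (wronskian_scaled dder) -exprS exprAC.
Qed.

Lemma wronskian_exp_ext (A I : set K) (f : K) n : subalgebra iota A ->
  @submodule K K^o A I -> I f -> f != 0 ->
  let B := blowup_chart A I f in let w := wronskian B B in
  ideal_gen B (ideal_exp A (wronskian A I) n) =
  scaled ((f ^+ r.+1) ^+ n) (ideal_exp B w n).
Proof.
move=> sA sI If f0 B w.
have AB : A `<=` B by apply: sub_chart.
have sB : subalgebra iota B by apply: chart_subalgebra.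
have genW : ideal_gen B (wronskian A I) = _ := wronskian_self_ext sA sI If f0.
by rewrite (gen_ideal_exp _ n sA sB AB) genW ideal_exp_scaled.
Qed.

(** Over the localization B at g, w lies in hB, so W_A(w) lies in h^(r+1) W_B(B), where W_B(B) is
    the extension of w. Clearing powers of g yields r+2 factors from w. *)
Lemma wronskian_of_principal (A : set K) (g h y : K) n : subalgebra iota A ->
  let w := wronskian A A in
  A g -> g != 0 -> h != 0 -> w (g ^+ n * h) ->
  (forall z, w z -> @localization K K^o g A (z / h)) ->
  wronskian A w y -> exists N, ideal_exp A w r.+2 (g ^+ N * y).
Proof.
move=> sA w Ag g0 h0 wgh wh Wy.
have sAA := subalg_submodule sA.
pose B := blowup_chart A A g.
have AB : A `<=` B by apply: sub_chart.
have sB : subalgebra iota B by apply: chart_subalgebra.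
have : scaled (h ^+ r.+1) (wronskian B B) y.
  rewrite -(wronskian_scaled dder).
  have : wronskian B w y.
    by move: y Wy; apply: gen_min; [exact: submoduleW AB (gen_submodule _ _)|exact: sub_gen].
  apply: wronskian_mono => z /wh; rewrite (localization_chart sA g0) => Bz.
  by apply/scaledP; rewrite // mulrC.
have -> : wronskian B B = ideal_gen B w.
  have /= := wronskian_chart dder A sA sAA Ag g0.
  by rewrite (ideal_mul1 sA sAA) -/B (gen_subalg sA sB AB).
move=> [y' wy' <-].
have [n' wy''] : exists n', ideal_mul A (ideal_exp A A n') w (g ^+ n' * y').
  by apply: (chart_clear sA).
rewrite (ideal_exp_subalg _ sA) (ideal_mul1 sA) in wy''; last exact: gen_submodule.
(* The r+1 factors h need g^n each, and y' needs g^n'. *)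
exists (n * r.+1 + n')%N.
have -> : g ^+ (n * r.+1 + n') * (h ^+ r.+1 * y') =
    (g ^+ n' * y') * (g ^+ n * h) ^+ r.+1.
  by rewrite exprD exprM mulrACA -exprMn mulrC.
by apply: ideal_mul_in; [exact: wy''|exact: (ideal_exp_expr r.+1 sA wgh)].
Qed.

End WronskianOnCharts.

(** * Finite generation of calJ *)

Section FiniteGeneration.
Variables (k K : fieldType) (iota : {rmorphism k -> K}).
Variables (r : nat) (delta : 'I_r -> K -> K^o).
Hypothesis dder : forall t, kderivation iota (delta t).
Variables (n : nat) (x : 'I_n -> K) (m : nat) (f : 'I_m.+1 -> K).
Local Notation R := (algebra_gen iota x).

Lemma wronskian_fin_gen : exists (F : finType) (d : F -> K),
  wronskian delta R (ideal_gen R (range f)) = ideal_gen R (range d).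
Proof.
pose rows (e : 'I_m.+1 + 'I_m.+1 * 'I_n) := match e with
  | inl i => jet delta (f i) | inr p => f p.1 *: djet delta (x p.2) end.
exists {ffun 'I_(1 + r) -> 'I_m.+1 + 'I_m.+1 * 'I_n}.
exists (fun phi : {ffun _} => \det (\matrix_q rows (phi q))).
rewrite /wronskian -gen_detset_span (span_calJ_rows dder) gen_detset_span.
congr ideal_gen; apply/seteqP; split=> [_ [v [Sv ->]]|_ [phi _ <-]].
  have /choice[phi phiE] q : exists e, v q = rows e.
    by have [[i ->]|[u [j ->]]] := Sv q; [exists (inl i)|exists (inr (u, j))].
  exists [ffun q => phi q] => //; congr (\det _); apply/row_matrixP => q.
  by rewrite !rowK ffunE phiE.
exists (fun q => rows (phi q)); split=> // q.
by case: (phi q) => [i|[u j]]; [left; exists i|right; exists u, j].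
Qed.

End FiniteGeneration.

(** * Comparison of both sides on the charts of the blowup *)

Theorem mainTheorem1
  (k K : fieldType) (iota : {rmorphism k -> K})
  (char0 : [pchar k] =i pred0)
  (R : set K) (n : nat) (x : 'I_n -> K)
  (Rgen : R = algebra_gen iota x)
  (Rfrac : fraction_field_of R)
  (L : set (K -> K^o)) (Lfol : foliation iota L)
  (r : nat) (delta : 'I_r -> K -> K^o)
  (deltabasis : is_basis setT L delta)
  (deltaR : forall i y, R y -> R (delta i y))
  (I : set K) (Iideal : ideal R I) (Ineq0 : exists2 y, I y & y != 0)
  (JI JIJI : set K)
  (JIE : is_calJ R x delta I JI)
  (JIJIE : is_calJ R x delta (ideal_mul R I JI) JIJI) :
  [/\ ideal_exp R JI r.+2 `<=` JIJI,
      nonsingular_on L (Bl R I) ->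
        exists N : nat,
          ideal_mul R (ideal_exp R I N) (ideal_exp R JI r.+2) =
          ideal_mul R (ideal_exp R I N) JIJI &
      (exists N : nat,
          ideal_mul R (ideal_exp R I N) (ideal_exp R JI r.+2) =
          ideal_mul R (ideal_exp R I N) JIJI) ->
        nonsingular_on L (Gauss_blowup delta (Bl R I))].
Proof.
have dder := basis_der Lfol deltabasis.
have sR : subalgebra iota R by rewrite Rgen; apply: algebra_gen_subalgebra.
have [_ sI] := Iideal.
have [m [f [If JIf]]] := JIE.
have {JIE JIf}JIw : JI = wronskian delta R I.
  by rewrite JIf If Rgen (calJ_wronskian dder).
(* Finitely many generators allow a single N in (ii). *)
have [F [d Fd]] : exists (F : finType) (d : F -> K), JIJI = ideal_gen R (range d).
  have [p [g [Eg ->]]] := JIJIE.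
  by rewrite Rgen (calJ_wronskian dder); apply: (wronskian_fin_gen dder).
have {JIJIE}JIJIw : JIJI = wronskian delta R (ideal_mul R I JI).
  have [p [g [Eg ->]]] := JIJIE.
  by rewrite Eg Rgen (calJ_wronskian dder).
have JIsub : ideal_exp R JI r.+2 `<=` JIJI.
  rewrite JIJIw {1}/ideal_exp -/(ideal_exp R JI r.+1) ideal_mulC {2}JIw.
  by apply: (wronskian_exp dder char0 sR); rewrite JIw; apply: wronskian_submodule.
rewrite JIw in JIJIw JIsub *.
split=> // [nonsing|[N EN] C].
- suff [N EN] : exists N, ideal_mul R (ideal_exp R I N) (ideal_gen R (range d)) `<=`
      ideal_mul R (ideal_exp R I N) (ideal_exp R (wronskian delta R I) r.+2).
    exists N; apply/seteqP; split; last by rewrite Fd.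
    by apply: ideal_mul_mono.
  rewrite {1 2 3}If; apply: (ideal_exp_absorb_fin sR) => i y; rewrite -Fd -If => Jy.
  (* A zero generator defines no chart; exponent 1 already makes the product zero. *)
  have [fi0|fi0] := eqVneq (f i) 0.
    exists 1%N; rewrite fi0 expr1 mul0r.
    by have [] := ideal_mul_submodule R (ideal_exp R I 1) (ideal_exp R (wronskian delta R I) r.+2).
  have Ifi : I (f i) by rewrite If; apply: sub_gen; exists i.
  pose B := blowup_chart R I (f i).
  have RB : R `<=` B by apply: sub_chart.
  have sB : subalgebra iota B by apply: chart_subalgebra.
  have fB : fraction_field_of B.
    by move=> z; have [a [b [Ra Rb b0 ->]]] := Rfrac z; exists a, b; split; auto.
  (* Up to a power of f_i, membership may be tested on the chart, where both modules carry the same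
     power of f_i as a factor. *)
  apply: (chart_clear sR) => //; rewrite -/B.
  rewrite (wronskian_exp_ext dder _ sR sI Ifi fi0) -/B.
  have : ideal_gen B JIJI y by apply: sub_gen.
  rewrite JIJIw (wronskian_mul_ext dder sR sI Ifi fi0) -/B.
  apply: scaled_mono => {Jy}y Wy.
  apply: (submodule_local sB (ideal_exp_submodule _ _ sB)) => P Pprime.
  have [|g [Bg nPg freeg]] := nonsing B _ P Pprime; first by exists R, (f i).
  have g0 : g != 0.
    by apply: contra_notN nPg => /eqP ->; have [[_ []]] := Pprime.
  have [h [h0 [s wgh] wh]] :=
    free_wedge_principal Lfol deltabasis sB fB Bg g0 freeg.
  rewrite (wedge_wronskian dder sB) in wgh wh.
  have [N EN] := wronskian_of_principal dder sB Bg g0 h0 wgh wh Wy.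
  exists (g ^+ N); split=> //.
    by rewrite -(ideal_exp_subalg N sB); apply: (ideal_exp_expr _ sB).
  move=> PgN; apply: nPg; have [iP P1 Pmul] := Pprime.
  elim: N PgN {EN} => [/P1//|N IHN]; rewrite exprS => /Pmul[]//.
  by rewrite -(ideal_exp_subalg N sB); apply: (ideal_exp_expr _ sB).
- move=> [B [h [[A [g [-> Ig g0 ->]]]]]] {B}.
  set B := blowup_chart R I g.
  have RB : R `<=` B by apply: sub_chart.
  have sB : subalgebra iota B by apply: chart_subalgebra.
  rewrite (wedge_wronskian dder sB); set w := wronskian delta B B => wh h0 ->.
  have sw : @submodule K K^o B w by apply: wronskian_submodule.
  (* The given equality is extended to the chart, where I^N is generated by g^N, and the common
     nonzero factor is cancelled. *)
  have wE : ideal_exp B w r.+2 = wronskian delta B w.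
    have genI : ideal_gen B (ideal_exp R I N) = scaled (g ^+ N) B.
      rewrite (gen_ideal_exp _ N sR sB RB) (gen_chart sR sI Ig g0) -/B.
      by rewrite ideal_exp_scaled (ideal_exp_subalg N sB).
    have := congr1 (ideal_gen B) EN.
    have genX Y := gen_ideal_mul (ideal_exp R I N) Y RB.
    rewrite !genX genI JIJIw (wronskian_exp_ext dder r.+2 sR sI Ig g0).
    rewrite (wronskian_mul_ext dder sR sI Ig g0) -/B -/w !ideal_mul_scaled !(ideal_mul1 sB).
    + by move/scaled_inj; apply; rewrite mulf_neq0 ?expf_neq0.
    + exact: wronskian_submodule.
    + exact: (ideal_exp_submodule w r.+2 sB).
  set C0 := blowup_chart B w h.
  have BC : B `<=` C0 by apply: sub_chart.
  have sC : subalgebra iota C0 by apply: chart_subalgebra.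
  apply: (principal_locally_free deltabasis sC h0).
  rewrite (wedge_wronskian dder sC).
  have genw : ideal_gen C0 w = scaled h C0 := gen_chart sB sw wh h0.
  (* With C the chart [C0]: h^(r+1) w_C = W_C(hC) = W_C(wC) = W_B(w) C = w^(r+2) C = h^(r+2) C. *)
  apply: (@scaled_inj _ (h ^+ r.+1)); first exact: expf_neq0.
  rewrite scaledM -exprSr -(wronskian_scaled dder) -genw.
  have := wronskian_chart dder B sB sw wh h0.
  rewrite /= ideal_mulC (ideal_mul1 sB sw) -/C0 => ->.
  rewrite -wE (gen_ideal_exp _ _ sB sC BC) genw ideal_exp_scaled.
  by rewrite (ideal_exp_subalg _ sC).
Qed.
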